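(* Let $f, g:\mathbb{C}\to\mathbb{C}$ be continuous functions with no common zeros. Assume that $\lim_{|z|\to\infty} \frac{f(z)}{g(z)} = \infty$ and that there is a constant $M>0$ such that $f(z)\neq 0$ for all $|z|\ge M$. Define $R:\bar{\mathbb{C}}\to\bar{\mathbb{C}}$ by $R(z)=\frac{f(z)}{g(z)}$ if $z\in\mathbb{C}$ and $g(z)\neq 0$, $R(z)=\infty$ if $z\in\mathbb{C}$ and $g(z)=0$, and $R(\infty)=\infty$. Then $R$ is continuous, and the degree of $R$ equals the winding number about $0$ of the loop $\tilde f:S^1\to\mathbb{C}\setminus\{0\}$, $\tilde f(\phi)=f(Me^{i\phi})$, $\phi\in[0,2\pi]$.
   Context: $\bar{\mathbb{C}}=\mathbb{C}\cup\{\infty\}$ is the Riemann sphere, identified with $S^2$ via stereographic projection. The degree of a continuous map $S^2\to S^2$ is the integer corresponding to its homotopy class under the isomorphism $\pi_2(S^2)\cong\mathbb{Z}$ normalized so that the identity map has degree $1$. The winding number (index) about $0$ of a loop in $\mathbb{C}\setminus\{0\}$ is its image under the isomorphism $\pi_1(\mathbb{C}\setminus\{0\})\cong\mathbb{Z}$ under which counterclockwise loops correspond to positive integers (for the standard counterclockwise unit circle it is $1$). *)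

(* Defs.v *)
(* C := complex numbers R[i] over a realType R
   (mathcomp-real-closed), with its norm topology; the Riemann sphere is the
   one-point compactification of C (homeomorphic to S^2 via stereographic
   projection). *)
From HB Require Import structures.
From mathcomp Require Import all_boot all_order all_algebra.
From mathcomp Require Import all_classical all_reals all_analysis.
From mathcomp Require Import complex.
Import Order.TTheory GRing.Theory Num.Theory.
Import numFieldTopology.Exports numFieldNormedType.Exports.

Set Implicit Arguments.
Unset Strict Implicit.
Unset Printing Implicit Defensive.

Local Open Scope classical_set_scope.
Local Open Scope ring_scope.

(* The complex plane, as a numClosedFieldType (hence a normed/topological space). *)
Definition CC (R : realType) : numClosedFieldType := R[i].

(* The Riemann sphere  \bar C = C u {oo}  ([None] is oo). *)
Definition Cbar (R : realType) : topologicalType :=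
  one_point_compactification (CC R).

(* e^{i phi} *)
Definition expi (R : realType) (phi : R) : CC R := (cos phi +i* sin phi)%C.

(* Homotopy of maps X -> Y: a map H : [0,1] x X -> Y, continuous for the
   (subspace of the) product topology, with H 0 = F and H 1 = G. *)
Definition homotopic (R : realType) (X Y : topologicalType) (F G : X -> Y) :=
  exists H : R -> X -> Y,
    {within `[0, 1] `*` [set: X], continuous (fun p : R * X => H p.1 p.2)} /\
    (forall x, H 0 x = F x) /\ (forall x, H 1 x = G x).

(* Standard representative of degree d on the Riemann sphere:
   z |-> z^d for d >= 0 (the constant 1 for d = 0, fixing oo for d > 0),
   z |-> (conj z)^|d| for d < 0 (fixing oo). *)
Definition std_map (R : realType) (d : int) (x : Cbar R) : Cbar R :=
  match x with
  | Some z => Some (if (0 <= d)%R then z ^+ absz d else (z^*) ^+ absz d)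
  | None => if d == 0 then Some 1 else None
  end.

(* F : \bar C -> \bar C has degree d: its homotopy class is the one of the
   standard degree-d map (free homotopy classes of maps S^2 -> S^2 are
   identified with pi_2(S^2) = Z since S^2 is simply connected; the identity,
   std_map 1, corresponds to 1). *)
Definition has_degree (R : realType) (F : Cbar R -> Cbar R) (d : int) : Prop :=
  homotopic R F (std_map d).

(* A loop gamma : [0, 2 pi] -> C \ {0} (gamma 0 = gamma (2 pi)) has winding
   number n about 0: it is homotopic through loops in C \ {0} to the standard
   loop phi |-> e^{i n phi}. (Free homotopy classes of loops in C\{0} are
   identified with pi_1(C \ {0}) = Z since that group is abelian; the
   counterclockwise unit circle corresponds to 1.) *)
Definition has_winding (R : realType) (gamma : R -> CC R) (n : int) : Prop :=
  exists H : R -> R -> CC R,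
    {within `[0, 1] `*` `[0, 2 * pi], continuous (fun p : R * R => H p.1 p.2)} /\
    (forall t phi, t \in `[0, 1] -> phi \in `[0, 2 * pi] -> H t phi != 0) /\
    (forall t, t \in `[0, 1] -> H t 0 = H t (2 * pi)) /\
    (forall phi, phi \in `[0, 2 * pi] -> H 0 phi = gamma phi) /\
    (forall phi, phi \in `[0, 2 * pi] -> H 1 phi = expi phi ^ n).

(* The map R = f/g on the Riemann sphere. *)
Definition Rmap (R : realType) (f g : CC R -> CC R) (x : Cbar R) : Cbar R :=
  match x with
  | Some z => if g z == 0 then None else Some (f z / g z)
  | None => None
  end.

(* Main.v *)
(* Write the sphere as the projective line, so that [Rmap f g] is [f : g].  Outside the
   disc of radius M, where f has no zero, g may be multiplied by a cutoff.  By genericity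
   (f, Im g) : disc -> R^3 can be perturbed to avoid 0; then over the zeros of f the segment
   from g to 1 avoids 0, and [f : g] is homotopic to [f : cutoff].  The latter only depends
   on the homotopy class of the loop f(M e^{i phi}) in C \ {0}, so that a winding number n
   yields the standard map of degree n.  Conversely the standard maps are pairwise non
   homotopic: a homotopy lifts to C^2 \ {0} over each of the two hemispheres, and the inner
   product of the two lifts along the equator is a loop in C \ {0} whose winding number is
   constant in time and equals the degree at both ends. *)
Require Import Defs.
From HB Require Import structures.
From mathcomp Require Import all_boot all_order all_algebra.
From mathcomp Require Import all_classical all_reals all_analysis.
From mathcomp Require Import complex.
From mathcomp Require Import ring lra.
Import Order.TTheory GRing.Theory Num.Theory.
Import numFieldTopology.Exports numFieldNormedType.Exports.
Local Open Scope classical_set_scope.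
Local Open Scope ring_scope.
Local Open Scope complex_scope.

Set Implicit Arguments.
Unset Strict Implicit.
Unset Printing Implicit Defensive.

(** A zero of [f] where [g] is a negative real blocks the straight deformation of [g] to 1.
    Excluding such points means making three real equations in two real unknowns unsolvable, but a
    merely continuous image of a disc may fill a cube. Hence numerator and denominator are first
    replaced by Lipschitz approximations, for which a counting argument works. The cutoff makes the
    point at infinity harmless: once the denominator vanishes beyond radius 2 M, a homotopy only
    needs a numerator without zeros outside the disc. The growth of f/g is spent on the continuity
    of the quotient map and on inserting the cutoff. All lifts follow one scheme: contract the
    parameter space to a point, cut time into uniformly small steps by compactness, and continue the
    lift by an explicit formula, an arctangent for arguments and an orthogonal projection for lines
    of C^2. *)

Notation re z := (complex.Re z).
Notation im z := (complex.Im z).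

(** * Modulus, real and imaginary parts with values in [R] *)

Section ComplexPlane.
Context {R : realType}.
Implicit Types (z w : CC R) (x y : R).

(* [x%:C] typed in [CC R], whose ring operations are those of the topological field. *)
Definition rc (x : R) : CC R := x%:C.

(** The norm of [CC R] takes its values in [CC R]; this is the modulus as an element of the ordered
    field [R]. *)
Definition nrm (z : CC R) : R := re `|z|.

Lemma rcD x y : rc (x + y) = rc x + rc y. Proof. exact: rmorphD. Qed.
Lemma rcN x : rc (- x) = - rc x. Proof. exact: rmorphN. Qed.
Lemma rcB x y : rc (x - y) = rc x - rc y. Proof. exact: rmorphB. Qed.
Lemma rcM x y : rc (x * y) = rc x * rc y. Proof. exact: rmorphM. Qed.
Lemma rcX x n : rc (x ^+ n) = rc x ^+ n. Proof. exact: rmorphXn. Qed.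
Lemma rc0 : rc 0 = 0. Proof. by []. Qed.
Lemma rc1 : rc 1 = 1. Proof. by []. Qed.
Lemma rc_inj : injective rc. Proof. exact: (@complexI R). Qed.
Lemma rc_eq0 x : (rc x == 0) = (x == 0). Proof. by rewrite -rc0 (inj_eq rc_inj). Qed.
Lemma re_rc x : re (rc x) = x. Proof. by []. Qed.
Lemma im_rc x : im (rc x) = 0. Proof. by []. Qed.

Lemma normCE z : `|z| = (nrm z)%:C.
Proof. by rewrite /nrm RRe_real // normr_real. Qed.

Lemma nrmE z : nrm z = Num.sqrt (re z ^+ 2 + im z ^+ 2).
Proof. by rewrite /nrm normc_def. Qed.

Lemma nrm_ge0 z : 0 <= nrm z.
Proof. by rewrite nrmE sqrtr_ge0. Qed.

Lemma sqr_nrm z : nrm z ^+ 2 = re z ^+ 2 + im z ^+ 2.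
Proof. by rewrite nrmE sqr_sqrtr // addr_ge0 // sqr_ge0. Qed.

Lemma nrmM z w : nrm (z * w) = nrm z * nrm w.
Proof. by apply: (@complexI R); rewrite -normCE normrM !normCE rmorphM. Qed.

Lemma nrmV z : nrm z^-1 = (nrm z)^-1.
Proof. by apply: (@complexI R); rewrite -normCE normfV !normCE fmorphV. Qed.

Lemma nrmD z w : nrm (z + w) <= nrm z + nrm w.
Proof. by rewrite -lecR rmorphD -!normCE ler_normD. Qed.

Lemma nrmN z : nrm (- z) = nrm z.
Proof. by rewrite /nrm normrN. Qed.

Lemma nrm_eq0 z : (nrm z == 0) = (z == 0).
Proof. by rewrite -(normr_eq0 z) normCE -(inj_eq (@complexI R)). Qed.

Lemma nrm_gt0 z : (0 < nrm z) = (z != 0).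
Proof. by rewrite lt_def nrm_ge0 andbT nrm_eq0. Qed.

Lemma nrm0 : nrm 0 = 0.
Proof. by apply/eqP; rewrite nrm_eq0. Qed.

Lemma nrm1 : nrm 1 = 1.
Proof. by rewrite /nrm normr1. Qed.

Lemma nrmX z n : nrm (z ^+ n) = nrm z ^+ n.
Proof. by elim: n => [|n IH]; rewrite ?expr0 ?nrm1 // !exprS nrmM IH. Qed.

Lemma nrm_real x : nrm (rc x) = `|x|.
Proof. by rewrite nrmE /= expr0n addr0 sqrtr_sqr. Qed.

Lemma le_re_nrm z : `|re z| <= nrm z.
Proof.
by rewrite -ler_sqr ?nnegrE ?nrm_ge0 // sqr_nrm real_normK ?num_real // lerDl sqr_ge0.
Qed.

Lemma le_im_nrm z : `|im z| <= nrm z.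
Proof.
by rewrite -ler_sqr ?nnegrE ?nrm_ge0 // sqr_nrm real_normK ?num_real // lerDr sqr_ge0.
Qed.

Lemma nrm_le z : nrm z <= `|re z| + `|im z|.
Proof.
rewrite -ler_sqr ?nnegrE ?nrm_ge0 ?addr_ge0 // sqr_nrm sqrrD.
rewrite !real_normK ?num_real // -addrA lerD2l lerDr mulrn_wge0 //.
Qed.

Lemma nrm_real_mul x z : 0 <= x -> nrm (rc x * z) = x * nrm z.
Proof. by move=> x0; rewrite nrmM nrm_real ger0_norm. Qed.

Lemma reD z w : re (z + w) = re z + re w. Proof. by case: z w => [a b] []. Qed.
Lemma imD z w : im (z + w) = im z + im w. Proof. by case: z w => [a b] []. Qed.
Lemma reN z : re (- z) = - re z. Proof. by case: z. Qed.
Lemma imN z : im (- z) = - im z. Proof. by case: z. Qed.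
Lemma reM z w : re (z * w) = re z * re w - im z * im w.
Proof. by case: z w => [a b] []. Qed.
Lemma imM z w : im (z * w) = re z * im w + im z * re w.
Proof. by case: z w => [a b] []. Qed.
Lemma conjE z : Num.conj z = (re z +i* - im z)%C.
Proof. by case: z. Qed.
Lemma complexP z w : re z = re w -> im z = im w -> z = w.
Proof. by case: z w => [a b] [c d] /= -> ->. Qed.

Lemma nrm_conj z : nrm (Num.conj z) = nrm z.
Proof. by rewrite /nrm norm_conjC. Qed.

Lemma mul_conj z : z * Num.conj z = rc (nrm z ^+ 2).
Proof. by rewrite -normCK normCE rcX. Qed.

End ComplexPlane.

(** * Continuity at a point, closed under the operations in use *)

Section ContinuityAt.
Context {R : realType} {X : topologicalType}.
Implicit Types (p : X).

Lemma ct_cst (Y : topologicalType) (c : Y) p : continuous_at p (fun=> c).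
Proof. exact: cvg_cst. Qed.

Lemma ct_id p : continuous_at p (fun x => x).
Proof. exact: cvg_id. Qed.

Lemma ct_comp (Y Z : topologicalType) (F : Y -> Z) (f : X -> Y) p :
  continuous_at p f -> continuous_at (f p) F -> continuous_at p (fun x => F (f x)).
Proof. exact: continuous_comp. Qed.

Lemma ct_pair (Y Z : topologicalType) (f : X -> Y) (g : X -> Z) p :
  continuous_at p f -> continuous_at p g -> continuous_at p (fun x => (f x, g x)).
Proof. by move=> cf cg; apply: cvg_pair. Qed.

Lemma ct_fst (Y Z : topologicalType) (f : X -> Y * Z) p :
  continuous_at p f -> continuous_at p (fun x => (f x).1).
Proof. by move=> cf; apply: (ct_comp cf); exact: cvg_fst. Qed.

Lemma ct_snd (Y Z : topologicalType) (f : X -> Y * Z) p :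
  continuous_at p f -> continuous_at p (fun x => (f x).2).
Proof. by move=> cf; apply: (ct_comp cf); exact: cvg_snd. Qed.

Lemma ct_near (Y : topologicalType) (f g : X -> Y) p :
  (\forall x \near p, f x = g x) -> continuous_at p f -> continuous_at p g.
Proof.
move=> fg cf; rewrite /continuous_at -(nbhs_singleton fg).
by apply: cvg_trans cf; apply: near_eq_cvg.
Qed.

Lemma ctD (K : numFieldType) (f g : X -> K) p :
  continuous_at p f -> continuous_at p g -> continuous_at p (fun x => f x + g x).
Proof. exact: cvgD. Qed.

Lemma ctN (K : numFieldType) (f : X -> K) p :
  continuous_at p f -> continuous_at p (fun x => - f x).
Proof. exact: cvgN. Qed.

Lemma ctM (K : numFieldType) (f g : X -> K) p :
  continuous_at p f -> continuous_at p g -> continuous_at p (fun x => f x * g x).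
Proof. exact: cvgM. Qed.

Lemma ctV (K : numFieldType) (f : X -> K) p :
  f p != 0 -> continuous_at p f -> continuous_at p (fun x => (f x)^-1).
Proof. exact: cvgV. Qed.

Lemma ctX (K : numFieldType) (f : X -> K) n p :
  continuous_at p f -> continuous_at p (fun x => f x ^+ n).
Proof.
move=> cf; elim: n => [|n IH]; first exact: ct_cst.
by under [X in continuous_at _ X]eq_fun do rewrite exprS; exact: ctM.
Qed.

Lemma ct_sum (K : numFieldType) n (f : nat -> X -> K) p :
  (forall k, (k < n)%N -> continuous_at p (f k)) ->
  continuous_at p (fun x => \sum_(k < n) f k x).
Proof.
elim: n => [|n IH] cf.
  by under [X in continuous_at _ X]eq_fun do rewrite big_ord0; exact: ct_cst.
under [X in continuous_at _ X]eq_fun do rewrite big_ord_recr /=.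
by apply: ctD; [apply: IH => k kn; apply: cf; exact: ltnW | exact: cf].
Qed.

Lemma ct_norm (f : X -> R) p : continuous_at p f -> continuous_at p (fun x => `|f x|).
Proof. by move=> cf; apply: cvg_norm. Qed.

Lemma ct_max (f g : X -> R) p :
  continuous_at p f -> continuous_at p g -> continuous_at p (fun x => Num.max (f x) (g x)).
Proof. exact: continuous_max. Qed.

Lemma ct_min (f g : X -> R) p :
  continuous_at p f -> continuous_at p g -> continuous_at p (fun x => Num.min (f x) (g x)).
Proof. exact: continuous_min. Qed.

Lemma ct_re (f : X -> CC R) p : continuous_at p f -> continuous_at p (fun x => re (f x)).
Proof.
move=> /cvgrPdist_lt cf; apply/cvgrPdist_lt => e e0.
have := cf e%:C; rewrite ltcR => /(_ e0); apply: filterS => x.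
rewrite normCE ltcR; apply: le_lt_trans; rewrite -reN -reD; exact: le_re_nrm.
Qed.

Lemma ct_im (f : X -> CC R) p : continuous_at p f -> continuous_at p (fun x => im (f x)).
Proof.
move=> /cvgrPdist_lt cf; apply/cvgrPdist_lt => e e0.
have := cf e%:C; rewrite ltcR => /(_ e0); apply: filterS => x.
rewrite normCE ltcR; apply: le_lt_trans; rewrite -imN -imD; exact: le_im_nrm.
Qed.

Lemma ct_complex (f g : X -> R) p : continuous_at p f -> continuous_at p g ->
  continuous_at p (fun x => (f x +i* g x)%C : CC R).
Proof.
move=> /cvgrPdist_lt cf /cvgrPdist_lt cg; apply/cvgrPdist_lt => e e0.
have [k ek] : exists k : R, e = k%:C by apply/complex_realP; rewrite realE ltW.
move: e0; rewrite ek (ltcR 0) => k0.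
have k2 : 0 < k / 2 by rewrite divr_gt0.
near=> x.
rewrite normCE ltcR; apply: le_lt_trans (nrm_le _) _.
rewrite reD imD reN imN /= (splitr k); apply: ltrD.
- by near: x; exact: cf.
- by near: x; exact: cg.
Unshelve. all: by end_near. Qed.

Lemma ct_dist (h : X -> CC R) p :
  (forall k : R, 0 < k -> \forall x \near p, nrm (h x - h p) < k) -> continuous_at p h.
Proof.
move=> hk; apply/cvgrPdist_lt => e e0.
have [k ek] : exists k : R, e = k%:C by apply/complex_realP; rewrite realE ltW.
move: e0; rewrite ek (ltcR 0) => /hk; apply: filterS => x.
by rewrite -normrN opprB normCE ltcR.
Qed.

Lemma ct_distR (h : X -> R) p :
  (forall k : R, 0 < k -> \forall x \near p, `|h p - h x| < k) -> continuous_at p h.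
Proof. by move=> hk; apply/cvgrPdist_lt. Qed.

Lemma ct_complexP (f : X -> CC R) p : continuous_at p (fun x => re (f x)) ->
  continuous_at p (fun x => im (f x)) -> continuous_at p f.
Proof.
move=> c1 c2; have := ct_complex c1 c2; apply: ct_near.
by apply: nearW => x; apply: complexP.
Qed.

Lemma ct_real (f : X -> R) p : continuous_at p f ->
  continuous_at p (fun x => rc (f x)).
Proof. by move=> cf; apply: ct_complex => //; exact: ct_cst. Qed.

Lemma ct_conj (f : X -> CC R) p : continuous_at p f ->
  continuous_at p (fun x => Num.conj (f x)).
Proof.
move=> cf; apply: ct_complexP.
  by under [X in continuous_at _ X]eq_fun do rewrite conjE /=; exact: ct_re.
by under [X in continuous_at _ X]eq_fun do rewrite conjE /=; apply: ctN; exact: ct_im.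
Qed.

Lemma ct_nrm (f : X -> CC R) p : continuous_at p f ->
  continuous_at p (fun x => nrm (f x)).
Proof. by move=> cf; apply: ct_re; exact: cvg_norm. Qed.

Lemma ct_cos (f : X -> R) p : continuous_at p f -> continuous_at p (fun x => cos (f x)).
Proof. by move=> cf; apply: (ct_comp cf); exact: continuous_cos. Qed.

Lemma ct_sin (f : X -> R) p : continuous_at p f -> continuous_at p (fun x => sin (f x)).
Proof. by move=> cf; apply: (ct_comp cf); exact: continuous_sin. Qed.

Lemma ct_atan (f : X -> R) p : continuous_at p f -> continuous_at p (fun x => atan (f x)).
Proof. by move=> cf; apply: (ct_comp cf); exact: continuous_atan. Qed.

Lemma ct_expi (f : X -> R) p : continuous_at p f -> continuous_at p (fun x => expi (f x)).
Proof. by move=> cf; apply: ct_complex; [exact: ct_cos | exact: ct_sin]. Qed.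

Lemma ct_gt (f : X -> R) p (a : R) : continuous_at p f -> a < f p ->
  \forall x \near p, a < f x.
Proof. by move=> cf; exact: cvgr_gt. Qed.

Lemma ct_lt (f : X -> R) p (a : R) : continuous_at p f -> f p < a ->
  \forall x \near p, f x < a.
Proof. by move=> cf; exact: cvgr_lt. Qed.

Lemma ct_neq0 (f : X -> CC R) p : continuous_at p f -> f p != 0 ->
  \forall x \near p, f x != 0.
Proof.
move=> cf; rewrite -nrm_gt0 => fp.
by have := ct_gt (ct_nrm cf) fp; apply: filterS => x; rewrite nrm_gt0.
Qed.

End ContinuityAt.

(** Recursion on the syntax of the function. Side conditions, such as nonvanishing denominators, and
    shapes it does not recognise are left as goals. *)
Ltac cts :=
  lazymatch goal with
  | |- continuous _ => let p := fresh "p" in move=> p; cts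
  | |- is_true _ => idtac
  | |- {for _, continuous _} => rewrite /prop_for; cts
  | |- continuous_at _ (fun=> ?c) => exact: ct_cst
  | |- continuous_at _ (fun x => x) => exact: ct_id
  | |- continuous_at _ fst => exact: cvg_fst
  | |- continuous_at _ snd => exact: cvg_snd
  | |- continuous_at _ rc => apply: ct_real; exact: ct_id
  | |- continuous_at _ nrm => apply: ct_nrm; exact: ct_id
  | |- continuous_at _ (@complex.Re _) => apply: ct_re; exact: ct_id
  | |- continuous_at _ (@complex.Im _) => apply: ct_im; exact: ct_id
  | |- continuous_at _ (@Num.conj _) => apply: ct_conj; exact: ct_id
  | |- continuous_at _ -%R => apply: ctN; exact: ct_id
  | |- continuous_at _ (@expi _) => apply: ct_expi; exact: ct_id
  | |- continuous_at _ (fun x => (@?f x).1) => apply: ct_fst; cts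
  | |- continuous_at _ (fun x => (@?f x).2) => apply: ct_snd; cts
  | |- continuous_at _ (fun x => (@?f x, @?g x)) => apply: ct_pair; cts
  | |- continuous_at _ (fun x => @?f x + @?g x) => apply: ctD; cts
  | |- continuous_at _ (fun x => - @?f x) => apply: ctN; cts
  | |- continuous_at _ (fun x => @?f x * @?g x) => apply: ctM; cts
  | |- continuous_at _ (fun x => (@?f x)^-1) => apply: ctV; cts
  | |- continuous_at _ (fun x => @?f x ^+ _) => apply: ctX; cts
  | |- continuous_at _ (fun x => `|@?f x|) => apply: ct_norm; cts
  | |- continuous_at _ (fun x => Num.max (@?f x) (@?g x)) => apply: ct_max; cts
  | |- continuous_at _ (fun x => Num.min (@?f x) (@?g x)) => apply: ct_min; cts
  | |- continuous_at _ (fun x => rc (@?f x)) => apply: ct_real; cts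
  | |- continuous_at _ (fun x => Complex (@?f x) (@?g x)) => apply: ct_complex; cts
  | |- continuous_at _ (fun x => complex.Re (@?f x)) => apply: ct_re; cts
  | |- continuous_at _ (fun x => complex.Im (@?f x)) => apply: ct_im; cts
  | |- continuous_at _ (fun x => nrm (@?f x)) => apply: ct_nrm; cts
  | |- continuous_at _ (fun x => Num.conj (@?f x)) => apply: ct_conj; cts
  | |- continuous_at _ (fun x => expi (@?f x)) => apply: ct_expi; cts
  | |- continuous_at _ (fun x => atan (@?f x)) => apply: ct_atan; cts
  | H : continuous ?f |- continuous_at _ ?f => exact: H
  | H : continuous ?F |- continuous_at _ (fun x => ?F (@?g x)) =>
      apply: (@ct_comp _ _ _ F g); [cts | exact: H]
  | H : continuous_at ?p ?f |- continuous_at ?p ?f => exact: H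
  | |- _ => idtac
  end.


(** * The exponential e^{i phi}, its kernel, and angle functions *)

Section Trigonometry.
Context {R : realType}.
Implicit Types (x y : R) (z : CC R).

Lemma expiD x y : expi (x + y) = expi x * expi y.
Proof. by apply: complexP; rewrite ?reM ?imM /= ?cosD ?sinD // addrC. Qed.

Lemma expi0 : expi 0 = 1 :> CC R.
Proof. by rewrite /expi cos0 sin0. Qed.

Lemma nrm_expi x : nrm (expi x) = 1.
Proof. by rewrite nrmE /= cos2Dsin2 sqrtr1. Qed.

Lemma expi_neq0 x : expi x != 0.
Proof. by rewrite -nrm_gt0 nrm_expi. Qed.

Lemma expiN x : expi (- x) = (expi x)^-1.
Proof.
by apply: (mulfI (expi_neq0 x)); rewrite -expiD subrr expi0 mulfV // expi_neq0.
Qed.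

Lemma conj_expi x : Num.conj (expi x) = expi (- x).
Proof. by rewrite conjE /expi cosN sinN. Qed.

Lemma expi2pi : expi (2 * pi) = 1 :> CC R.
Proof. by rewrite mulr_natl /expi cos2pi sin2pi. Qed.

Lemma expipi : expi pi = -1 :> CC R.
Proof. by rewrite /expi cospi sinpi; apply: complexP; rewrite /= ?oppr0. Qed.

Lemma expiX x n : expi x ^+ n = expi (n%:R * x).
Proof.
elim: n => [|n IH]; first by rewrite mul0r expi0.
by rewrite exprS IH -expiD mulrS mulrDl mul1r.
Qed.

Lemma expiXz x (n : int) : expi x ^ n = expi (n%:~R * x).
Proof.
case: n => n; first by rewrite -exprnP expiX.
by rewrite NegzE -exprnN expiX mulrNz mulNr expiN.
Qed.

(** Reduce [x] modulo 2 pi to [y] in [0, 2 pi). On [0, pi] the cosine is injective, and on (pi, 2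
    pi) the sine does not vanish. *)
Lemma expi_eq1 x : expi x = 1 -> exists n : int, x = 2 * pi * n%:~R.
Proof.
move=> ex; have p0 := pi_gt0 R.
pose n := Num.floor (x / (2 * pi)); exists n.
have hp : 0 < 2 * pi :> R by rewrite mulr_gt0.
pose y := x - 2 * pi * n%:~R.
have y0 : 0 <= y.
  rewrite subr_ge0 mulrC -ler_pdivlMr //; exact: Num.Theory.floor_le_tmp.
have y1 : y < 2 * pi.
  have := floorD1_gt (x / (2 * pi)).
  rewrite -/n ltr_pdivrMr // intrD mulrDl mul1r /y; lra.
have ey : expi y = 1.
  have -> : y = x + (- n)%:~R * (2 * pi) by rewrite intrN /y; ring.
  by rewrite expiD ex mul1r -expiXz expi2pi exp1rz.
have cy : cos y = 1 by case: ey.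
have sy : sin y = 0 by case: ey.
suff : y = 0 by rewrite /y => /eqP; rewrite subr_eq0 => /eqP.
have [yp|yp] := leP y pi.
  by apply: cos_inj; rewrite ?in_itv /= ?cos0 ?y0 ?yp ?lexx ?ltW.
have : 0 < sin (y - pi) by apply: sin_gt0_pi; lra.
by rewrite sinB sinpi cospi sy !(mul0r, mulr0) subrr ltxx.
Qed.

(** Two distinct multiples of 2 pi are more than pi apart, so by the intermediate value theorem [u]
    would also take a value half a turn away, where e^{iu} is -1. *)
Lemma expi_const (u : R -> R) a b : a <= b -> continuous u ->
  (forall x, a <= x <= b -> expi (u x) = 1) -> u a = u b.
Proof.
move=> ab cu u1.
have p0 := pi_gt0 R.
have [n un] := expi_eq1 (u1 a (introT andP (conj (lexx a) ab))).
have [m um] := expi_eq1 (u1 b (introT andP (conj ab (lexx b)))).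
have gap k l : (k < l)%R -> 2 * pi * (k%:~R : R) + pi <= 2 * pi * l%:~R.
  move=> kl; have : (k%:~R + 1 : R) <= l%:~R.
    by rewrite -[1]/(1%:~R) -intrD ler_int lezD1.
  by move=> h; nra.
have contra v : Num.min (u a) (u b) <= v <= Num.max (u a) (u b) -> expi v != 1 -> False.
  move=> vab v1; have [|c cab uc] := @IVT R u a b v ab _ vab.
    exact: continuous_subspaceT.
  by move/eqP: v1; apply; rewrite -uc u1 //; move: cab; rewrite in_itv.
have N11 : (-1 : CC R) != 1.
  by rewrite eq_sym -subr_eq0 opprK -[1 + 1]/(2%:R) pnatr_eq0.
have [nm|nm|nm] := ltgtP n m; last by rewrite un um nm.
- have := gap _ _ nm; rewrite -un -um => h; exfalso.
  apply: (contra (u a + pi)); first by rewrite ge_min le_max h; lra.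
  by rewrite expiD u1 ?lexx // mul1r expipi.
- have := gap _ _ nm; rewrite -un -um => h; exfalso.
  apply: (contra (u b + pi)); first by rewrite ge_min le_max h; lra.
  by rewrite expiD u1 ?lexx ?ab // mul1r expipi.
Qed.

Lemma polar_right z : 0 < re z -> z = rc (nrm z) * expi (atan (im z / re z)).
Proof.
move=> z0; set s := im z / re z.
have s0 : 0 < 1 + s ^+ 2 by rewrite ltr_pwDl // sqr_ge0.
have nz : nrm z = re z * Num.sqrt (1 + s ^+ 2).
  rewrite -[X in X * _]ger0_norm ?ltW // -sqrtr_sqr -sqrtrM ?sqr_ge0 //.
  by rewrite nrmE; congr Num.sqrt; rewrite /s; field; rewrite gt_eqF.
have sq0 : Num.sqrt (1 + s ^+ 2) != 0 by rewrite gt_eqF // sqrtr_gt0.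
have sa : sin (atan s) = s * cos (atan s).
  by rewrite -{2}(atanK s) /tan mulfVK // cos_atan invr_eq0.
apply: complexP; rewrite ?reM ?imM re_rc im_rc !mul0r ?subr0 ?addr0 /= ?sa cos_atan nz.
  by field.
by rewrite /s; field; rewrite sq0 gt_eqF.
Qed.

(* The angle in [0, pi] between [z] and the positive real axis; this half-angle formula
   is continuous off 0, the real axis included. *)
Definition ang z : R := pi / 2 - 2 * atan (re z / (nrm z + `|im z|)).

Lemma ang_den z : z != 0 -> 0 < nrm z + `|im z|.
Proof. by rewrite -nrm_gt0 => h; rewrite ltr_pwDl. Qed.

(** With s the quotient inside [ang], the cosine and sine of [ang z] are the sine and cosine of 2
    atan s, and the double-angle formulas apply. *)
Lemma ang_cos_sin z : z != 0 ->
  nrm z * cos (ang z) = re z /\ nrm z * sin (ang z) = `|im z|.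
Proof.
move=> z0; have d0 := ang_den z0; have n0 : 0 < nrm z by rewrite nrm_gt0.
set s := re z / (nrm z + `|im z|).
have s0 : 0 < 1 + s ^+ 2 by rewrite ltr_pwDl // sqr_ge0.
have ca : cos (atan s) ^+ 2 = (1 + s ^+ 2)^-1.
  by rewrite cos_atan exprVn sqr_sqrtr // ltW.
have c0 : cos (atan s) != 0 by rewrite cos_atan invr_eq0 gt_eqF // sqrtr_gt0.
have sa : sin (atan s) = s * cos (atan s).
  by rewrite -{2}(atanK s) /tan mulfVK.
(* Pythagoras in the form (|z| + |im z|)^2 + (re z)^2 = 2 |z| (|z| + |im z|). *)
have q : (1 + s ^+ 2)^-1 = (nrm z + `|im z|) / (2 * nrm z).
  have sn : nrm z ^+ 2 = re z ^+ 2 + `|im z| ^+ 2.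
    by rewrite sqr_nrm real_normK // num_real.
  have -> : 1 + s ^+ 2 = (2 * nrm z) / (nrm z + `|im z|).
    have -> : 2 * nrm z / (nrm z + `|im z|) =
      2 * nrm z * (nrm z + `|im z|) / (nrm z + `|im z|) ^+ 2.
      by field; rewrite gt_eqF.
    have -> : 2 * nrm z * (nrm z + `|im z|) = (nrm z + `|im z|) ^+ 2 + re z ^+ 2.
      have -> : re z ^+ 2 = nrm z ^+ 2 - `|im z| ^+ 2 by rewrite sn addrK.
      by ring.
    by rewrite /s; field; rewrite gt_eqF.
  by rewrite invf_div.
have e : pi / 2 - 2 * atan s = - (2 * atan s - pi / 2) by ring.
rewrite /ang -/s e cosN sinN cosBpihalf sinBpihalf mulr_natl sin_mulr2n cos_mulr2n opprK.
rewrite ca sa q; split.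
  have -> : cos (atan s) * (s * cos (atan s)) = s * cos (atan s) ^+ 2 by ring.
  by rewrite ca q /s -mulr_natl; field; rewrite !gt_eqF.
by rewrite -mulr_natl; field; rewrite gt_eqF.
Qed.

Lemma ang_range z : z != 0 -> 0 <= ang z <= pi.
Proof.
move=> z0; have d0 := ang_den z0.
have h : `|re z / (nrm z + `|im z|)| <= 1.
  rewrite normf_div (gtr0_norm d0) ler_pdivrMr // mul1r.
  by apply: le_trans (le_re_nrm z) _; rewrite lerDl.
move: h; rewrite ler_norml => /andP[h1 h2].
have := le_atan h1; have := le_atan h2; rewrite atanN !atan1 /ang; lra.
Qed.

Lemma ct_ang z : z != 0 -> continuous_at z ang.
Proof.
move=> z0; rewrite /ang; cts; first by rewrite gt_eqF // ang_den.
all: by cts.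
Qed.

End Trigonometry.

(** * Retraction of the line onto a segment *)

Section Clamp.
Context {R : realType}.
Implicit Types (a b x : R).

(** Precomposing with this retraction turns a function continuous within [a, b] into a globally
    continuous one, which avoids subspace topologies later on. *)
Definition clamp a b x : R := Num.max a (Num.min b x).

Lemma clamp_range a b x : a <= b -> a <= clamp a b x <= b.
Proof. by move=> ab; rewrite /clamp le_max lexx /= ge_max ab ge_min lexx. Qed.

Lemma clamp_id a b x : a <= x <= b -> clamp a b x = x.
Proof. by move=> /andP[ax xb]; rewrite /clamp (min_idPr xb) (max_idPr ax). Qed.

Lemma clamp_le a b x : a <= b -> x <= a -> clamp a b x = a.
Proof.
by move=> ab xa; rewrite /clamp (min_idPr (le_trans xa ab)) (max_idPl xa).
Qed.

Lemma clamp_ge a b x : a <= b -> b <= x -> clamp a b x = b.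
Proof. by move=> ab bx; rewrite /clamp (min_idPl bx) (max_idPr ab). Qed.

Lemma ct_clamp (X : topologicalType) a b (f : X -> R) p :
  continuous_at p f -> continuous_at p (fun q => clamp a b (f q)).
Proof. by move=> cf; rewrite /clamp; cts. Qed.

End Clamp.

Lemma within_continuous_comp_in (X Y Z : topologicalType) (A : set Y) (F : Y -> Z)
    (r : X -> Y) : {within A, continuous F} -> continuous r -> (forall x, A (r x)) ->
  continuous (fun x => F (r x)).
Proof.
move=> /subspace_continuousP cF cr Ar x W /(cF _ (Ar x)) /=.
rewrite !nbhs_simpl /= /within /= => h.
move: (cr x _ h); rewrite !nbhs_simpl /=; apply: filterS => y /=; apply.
exact: Ar.
Qed.

(** Off the zero set of [y] only one branch is seen locally; on it both branches tend to the common
    value. *)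
Lemma ct_glue (R : realType) (X Y : topologicalType) (y : X -> R) (F G : X -> Y) p :
  continuous_at p y -> continuous_at p F -> continuous_at p G ->
  (y p = 0 -> F p = G p) -> continuous_at p (fun x => if 0 <= y x then F x else G x).
Proof.
move=> cy cF cG FG; have [yp|yp|yp] := ltgtP 0 (y p).
- apply: ct_near cF; have := ct_gt cy yp.
  by apply: filterS => x /ltW ->.
- apply: ct_near cG; have := ct_lt cy yp.
  by apply: filterS => x; rewrite ltNge => /negbTE ->.
- rewrite /continuous_at -yp lexx => W WF.
  have h1 := cF _ WF; rewrite (FG (esym yp)) in WF; have h2 := cG _ WF.
  rewrite !nbhs_simpl /= in h1 h2 *.
  by apply: filterS (filterI h1 h2) => x /= [h h']; case: ifP.
Qed.

(** * Homotopy as a symmetric and transitive relation *)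

Section Homotopy.
Context {R : realType} {X Y : topologicalType}.
Implicit Types (F G H : X -> Y).

Lemma homotopicP F G : homotopic R F G <-> exists H : R * X -> Y,
  [/\ continuous H, forall x, H (0, x) = F x & forall x, H (1, x) = G x].
Proof.
split=> [[H [cH [H0 H1]]]|[H [cH H0 H1]]]; last first.
  exists (fun t x => H (t, x)); split=> //; apply: continuous_subspaceT.
  by cts.
exists (fun p => H (clamp 0 1 p.1) p.2); split=> [|x|x] /=.
- apply: (within_continuous_comp_in (r := fun p : R * X => (clamp 0 1 p.1, p.2)) cH).
    by cts; apply: ct_clamp; cts.
  by move=> x; split=> //=; rewrite in_itv /=; apply: clamp_range.
- by rewrite clamp_id ?H0 // lexx ler01.
- by rewrite clamp_id ?H1 // lexx ler01.
Qed.

Lemma homotopic_sym F G : homotopic R F G -> homotopic R G F.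
Proof.
move=> /homotopicP[H [cH H0 H1]]; apply/homotopicP.
exists (fun p => H (1 - p.1, p.2)); split=> [|x|x] /=; first by cts.
  by rewrite subr0.
by rewrite subrr.
Qed.

Lemma homotopic_trans G F H : homotopic R F G -> homotopic R G H -> homotopic R F H.
Proof.
move=> /homotopicP[K [cK K0 K1]] /homotopicP[L [cL L0 L1]]; apply/homotopicP.
exists (fun p => if 0 <= 1 - 2 * p.1 then K (2 * p.1, p.2) else L (2 * p.1 - 1, p.2)).
split=> [p|x|x] /=.
- apply: ct_glue; try by cts.
  by move=> /eqP; rewrite subr_eq0 => /eqP <-; rewrite subrr K1 L0.
- by rewrite mulr0 subr0 ler01 K0.
- have -> : 2 * 1 - 1 = 1 :> R by ring.
  by rewrite ifF ?L1 //; apply/negbTE; rewrite -ltNge; lra.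
Qed.

End Homotopy.

(** * Extrema on compact sets; compact discs and annuli *)

Section Compactness.
Context {R : realType}.

Lemma compact_lower_bound (X : topologicalType) (K : set X) (h : X -> R) :
  compact K -> continuous h -> (forall x, K x -> 0 < h x) ->
  exists2 d : R, 0 < d & forall x, K x -> d <= h x.
Proof.
move=> cK ch h0; have [K0|/set0P/negP/negPn/eqP K0] := pselect (K !=set0); last first.
  by exists 1 => // x; rewrite K0.
have [c cK' cmin] := compact_EVT_min K0 cK (continuous_subspaceT ch).
exists (h c); first by apply: h0; rewrite inE in cK'.
by move=> x Kx; apply: cmin; rewrite inE.
Qed.

Lemma compact_upper_bound (X : topologicalType) (K : set X) (h : X -> R) :
  compact K -> continuous h ->
  exists2 d : R, 0 < d & forall x, K x -> `|h x| <= d.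
Proof.
move=> cK ch; have [K0|/set0P/negP/negPn/eqP K0] := pselect (K !=set0); last first.
  by exists 1 => // x; rewrite K0.
have ch' : continuous (fun x => `|h x|) by cts.
have [c cK' cmax] := compact_EVT_max K0 cK (continuous_subspaceT ch').
exists (`|h c| + 1); first by rewrite ltr_wpDl.
move=> x Kx; apply: le_trans (_ : `|h c| <= _); last by rewrite lerDl.
by apply: cmax; rewrite inE.
Qed.

Lemma closed_nrm_le (r : R) : closed [set z : CC R | nrm z <= r].
Proof.
apply: (@closed_comp _ _ _ [set x : R | x <= r]); last exact: closed_le.
by move=> z _; cts.
Qed.

Lemma closed_nrm_ge (r : R) : closed [set z : CC R | r <= nrm z].
Proof.
apply: (@closed_comp _ _ _ [set x : R | r <= x]); last exact: closed_ge.
by move=> z _; cts.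
Qed.

Lemma compact_disc (r : R) : compact [set z : CC R | nrm z <= r].
Proof.
pose f (p : R * R) : CC R := (p.1 +i* p.2)%C.
apply: (@subclosed_compact _ _ (f @` (`[- r, r] `*` `[- r, r]))).
- exact: closed_nrm_le.
- apply: continuous_compact; first by apply: continuous_subspaceT; rewrite /f; cts.
  by apply: compact_setX; exact: segment_compact.
- move=> z /= zr; exists (re z, im z); last by rewrite /f; case: z {zr}.
  split=> /=; rewrite in_itv /= -ler_norml; apply: le_trans zr.
    exact: le_re_nrm.
  exact: le_im_nrm.
Qed.

Lemma compact_annulus (r s : R) : compact [set z : CC R | r <= nrm z <= s].
Proof.
apply: (@subclosed_compact _ _ [set z | nrm z <= s]); last 2 first.
- exact: compact_disc.
- by move=> z /andP[].
- rewrite (_ : mkset _ = [set z | r <= nrm z] `&` [set z | nrm z <= s]).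
    by apply: closedI; [exact: closed_nrm_ge | exact: closed_nrm_le].
  by apply/seteqP; split=> z /= /andP.
Qed.

End Compactness.

(** * Neighbourhoods of infinity and continuity of quotients into the sphere *)

Section RiemannSphere.
Context {R : realType}.

Definition far (r : R) (y : Cbar R) : bool := if y is Some z then r < nrm z else true.

Lemma near_infty (r : R) : \forall y \near (None : Cbar R), far r y.
Proof.
exists [set z : CC R | nrm z <= r].
  by split; [exact: compact_disc | exact: closed_nrm_le].
move=> y [[z /= /negP]|->//].
by rewrite -ltNge => h <-.
Qed.

Lemma cvg_infty (X : topologicalType) (p : X) (h : X -> Cbar R) :
  (forall r, \forall x \near p, far r (h x)) -> h @ p --> (None : Cbar R).
Proof.
move=> hfar W [K [cK _]] KW; rewrite nbhs_simpl /=.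
have [|d _ dK] := @compact_upper_bound R _ K nrm cK; first by cts.
have := hfar d; apply: filterS => x; case e : (h x) => [z|] /= hx; apply: KW.
  left; exists z => //= Kz; have := dK z Kz.
  by rewrite ger0_norm ?nrm_ge0 // leNgt hx.
by right.
Qed.

Lemma ct_Some (X : topologicalType) (f : X -> CC R) p :
  continuous_at p f -> continuous_at p (fun x => Some (f x) : Cbar R).
Proof.
by move=> cf; apply: (ct_comp cf); exact: one_point_compactification_some_continuous.
Qed.

(* This suffices because X x C is open in X x Cbar. *)
Lemma ct_at_Some (X Y : topologicalType) (h : X * Cbar R -> Y) (x : X) (z : CC R) :
  continuous_at (x, z) (fun p : X * CC R => h (p.1, Some p.2)) ->
  continuous_at (x, Some z : Cbar R) h.
Proof.
move=> ch W Wh; rewrite nbhs_simpl /=.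
have [[U V] /= [Ux Vz] UV] := ch W Wh.
exists (U, Some @` V); first by split=> //; exact: one_point_compactification_some_nbhs.
by move=> [a b] /= [Ua [c Vc <-]]; exact: (UV (a, c)).
Qed.

(** The point [a : b] of the projective line. The pair (0, 0) is sent to infinity by default, so
    continuity is only claimed away from it. *)
Definition quot (a b : CC R) : Cbar R := if b == 0 then None else Some (a / b).

Lemma far_quot (a b : CC R) (r : R) : r * nrm b < nrm a -> far r (quot a b).
Proof.
rewrite /quot; case: eqP => //= /eqP b0.
by rewrite nrmM nrmV ltr_pdivlMr ?nrm_gt0.
Qed.

Lemma ct_quot (X : topologicalType) (A B : X -> CC R) p :
  continuous_at p A -> continuous_at p B -> ~ (A p = 0 /\ B p = 0) ->
  continuous_at p (fun x => quot (A x) (B x)).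
Proof.
move=> cA cB AB; have [Bp|Bp] := eqVneq (B p) 0.
  rewrite /continuous_at {2}/quot Bp eqxx; apply: cvg_infty => r.
  have : continuous_at p (fun x => nrm (A x) - r * nrm (B x)) by cts.
  have [A0|A0] := eqVneq (A p) 0; first by case: AB.
  move=> /(@ct_gt _ _ _ _ 0); rewrite Bp nrm0 mulr0 subr0 nrm_gt0 => /(_ A0).
  by apply: filterS => x; rewrite subr_gt0; exact: far_quot.
apply: (@ct_near _ (Cbar R) (fun x => Some (A x / B x) : Cbar R)).
  by have := ct_neq0 cB Bp; apply: filterS => x; rewrite /quot => /negbTE ->.
by apply: ct_Some; cts.
Qed.

End RiemannSphere.

(** * Uniform subdivision of time and continuous choice of an argument *)

Section Lifting.
Context {R : realType} {X : topologicalType}.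
Implicit Types (K : set X).

(** Positivity on the diagonal s = s' persists for nearby times; compactness of [0, 1] x K makes the
    admissible time gap uniform. In use, [Q] says that the values at the two times are close enough
    to continue a lift. *)
Lemma diagonal_steps K (Q : R * (R * X) -> R) : compact K -> continuous Q ->
  (forall s x, 0 <= s <= 1 -> K x -> 0 < Q (s, (s, x))) ->
  exists2 N : nat, (0 < N)%N &
    forall k x, (k < N)%N -> K x -> 0 < Q (k%:R / N%:R, (k.+1%:R / N%:R, x)).
Proof.
move=> cK cQ Q0.
pose P (N : nat) (p : R * X) :=
  forall s' : R, `|s' - p.1| <= N.+1%:R^-1 -> 0 < Q (p.1, (s', p.2)).
have cI : compact (`[0, 1]%classic `*` K : set (R * X)).
  by apply: compact_setX => //; exact: segment_compact.
move/compact_near_coveringP : cI => /(_ nat \oo P _) [].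
  move=> [s x] [/= s01 Kx]; rewrite /= in_itv /= in s01.
  have h : \forall p \near (s, (s, x)), 0 < Q p by apply: ct_gt; [exact: cQ | exact: Q0].
  have [[U V'] /= [Us [[V W] /= [Vs Wx] VW]] UV] := h.
  have [e /= e0 eV] : exists2 e : R, 0 < e & forall y, `|s - y| < e -> V y.
    by case/nbhs_ballP: Vs => e /= e0 eV; exists e => // y ye; apply: eV.
  have e2 : 0 < e / 2 by rewrite divr_gt0.
  (* Half of [e] is for moving the base time, the other half for the gap between the two times. *)
  have Us2 : nbhs s [set y : R | U y /\ `|s - y| < e / 2].
    by apply: filterI => //; apply/nbhs_ballP; exists (e / 2).
  have h2 : \forall N \near \oo, (N.+1%:R^-1 : R) < e / 2.
    exact: near_infty_natSinv_lt (PosNum e2).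
  exists ([set y | U y /\ `|s - y| < e / 2] `*` W, [set N : nat | (N.+1%:R^-1 : R) < e / 2]).
    by split=> //; exists ([set y | U y /\ `|s - y| < e / 2], W).
  move=> [[s1 x1] N] /= [[[Us1 ss1] Wx1] Ne] s' hs'.
  apply: (UV (s1, (s', x1))); split=> //=; apply: (VW (s', x1)); split=> //=.
  apply: eV; have -> : s - s' = (s - s1) - (s' - s1) by ring.
  apply: le_lt_trans (ler_normB _ _) _; rewrite (splitr e); apply: ltr_leD => //.
  by apply: le_trans hs' _; exact: ltW.
move=> N _ /(_ N (leqnn N)) h; exists N.+1 => // k x kN Kx.
apply: (h (k%:R / N.+1%:R, x)).
  split=> //=; rewrite in_itv /= divr_ge0 //= ler_pdivrMr ?ltr0n // mul1r ler_nat.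
  exact: ltnW.
rewrite /= -mulrBl mulrS addrK mul1r ger0_norm //.
Qed.

Lemma polar_exists (z : CC R) : z != 0 -> exists t : R, z = rc (nrm z) * expi t.
Proof.
move=> z0; have [c s] := ang_cos_sin z0.
have [i0|i0] := leP 0 (im z).
  exists (ang z); apply: complexP; rewrite ?reM ?imM re_rc im_rc !mul0r ?subr0 ?addr0 //=.
  by rewrite s ger0_norm.
exists (- ang z); apply: complexP; rewrite ?reM ?imM re_rc im_rc !mul0r ?subr0 ?addr0 /=.
  by rewrite cosN c.
by rewrite sinN mulrN s ltr0_norm // opprK.
Qed.

(** Starting from an argument of the constant [c], add the small rotations between consecutive
    times. Each has its ratio in the right half plane, where the argument is an arctangent depending
    continuously on [x]. *)
Lemma argument_lift K (G : R * X -> CC R) (c : CC R) :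
  compact K -> continuous G -> (forall x, G (0, x) = c) ->
  (forall s x, 0 <= s <= 1 -> K x -> G (s, x) != 0) ->
  exists2 theta : X -> R, (forall x, K x -> continuous_at x theta) &
    forall x, K x -> G (1, x) = rc (nrm (G (1, x))) * expi (theta x).
Proof.
move=> cK cG G0 Gn0.
have [K0|[x0 Kx0]] : K = set0 \/ K !=set0.
- by have [?|/set0P/negP/negPn/eqP ?] := pselect (K !=set0); [right|left].
- by exists (fun=> 0) => x; rewrite K0.
have c0 : c != 0 by rewrite -(G0 x0); apply: Gn0; rewrite ?lexx ?ler01.
have [t0 ct0] := polar_exists c0.
(* [q] has the argument of the ratio G(s')/G(s) and is |G(s)|^2 > 0 on the diagonal. *)
pose q (s s' : R) x := G (s', x) * Num.conj (G (s, x)).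
have [|s x s01 Kx|N N0 step] := @diagonal_steps K (fun p => re (q p.1 p.2.1 p.2.2)) cK.
- by rewrite /q; cts.
- by rewrite /q /= mul_conj re_rc exprn_gt0 // nrm_gt0; exact: Gn0.
pose a (k : nat) x := im (q (k%:R / N%:R) (k.+1%:R / N%:R) x) /
                      re (q (k%:R / N%:R) (k.+1%:R / N%:R) x).
exists (fun x => t0 + \sum_(k < N) atan (a k x)).
  move=> x Kx; apply: ctD; first exact: ct_cst.
  apply: (@ct_sum X R N (fun k x => atan (a k x))) => k kN; rewrite /a /q; cts.
  by rewrite gt_eqF //; exact: step.
move=> x Kx.
suff h m : (m <= N)%N ->
    G (m%:R / N%:R, x) = rc (nrm (G (m%:R / N%:R, x))) *
                         expi (t0 + \sum_(k < m) atan (a k x)).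
  by have := h N (leqnn N); rewrite divff // pnatr_eq0 -lt0n.
elim: m => [_|m IH mN].
  by rewrite mul0r big_ord0 addr0 G0.
have Gm : G (m%:R / N%:R, x) != 0.
  apply: Gn0 => //; rewrite divr_ge0 //= ler_pdivrMr ?ltr0n // mul1r ler_nat.
  exact: ltnW.
have := polar_right (step m x mN Kx); rewrite -/(a m x) /= => hq.
have {}IH := IH (ltnW mN).
have n0 : rc (nrm (G (m%:R / N%:R, x))) ^+ 2 != 0.
  by rewrite expf_neq0 // rc_eq0 nrm_eq0.
(* G_{m+1} |G_m|^2 = q G_m: the polar forms of [q] and of G_m multiply. *)
apply: (mulIf n0); rewrite -rcX -mul_conj mulrC.
rewrite big_ord_recr /= addrA expiD.
transitivity (q (m%:R / N%:R) (m.+1%:R / N%:R) x * G (m%:R / N%:R, x)).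
  by rewrite /q; ring.
rewrite mul_conj hq [X in _ * X = _]IH /q nrmM nrm_conj rcM rcX; ring.
Qed.

End Lifting.

(** * Winding numbers through angle functions, and their agreement with homotopy classes of loops *)

Section Winding.
Context {R : realType}.
Implicit Types (gamma delta : R -> CC R) (n m : int).

(** Unlike a homotopy to a standard loop, an angle function can be added and subtracted. The polar
    equation says nothing at a zero of [gamma], so nonvanishing is required separately for
    uniqueness. *)
Definition wind gamma n := exists theta : R -> R, [/\ continuous theta,
  forall phi, 0 <= phi <= 2 * pi -> gamma phi = rc (nrm (gamma phi)) * expi (theta phi) &
  theta (2 * pi) = theta 0 + 2 * pi * n%:~R].

Lemma ge0_2pi : 0 <= 2 * pi :> R.
Proof. by rewrite mulr_ge0 // pi_ge0. Qed.

Lemma wind_eq gamma delta n :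
  (forall phi, 0 <= phi <= 2 * pi -> gamma phi = delta phi) ->
  wind gamma n -> wind delta n.
Proof.
by move=> gd [th [cth h e]]; exists th; split=> // phi hphi; rewrite -gd //; exact: h.
Qed.

Lemma wind_unique gamma n m : (forall phi, 0 <= phi <= 2 * pi -> gamma phi != 0) ->
  wind gamma n -> wind gamma m -> n = m.
Proof.
move=> g0 [t [ct ht et]] [u [cu hu eu]].
have := @expi_const R (fun x => t x - u x) 0 (2 * pi) ge0_2pi _ _.
rewrite et eu => h; have {h} : t 0 - u 0 = t 0 + 2 * pi * n%:~R - (u 0 + 2 * pi * m%:~R).
  apply: h; first by cts.
  move=> x hx; have nx : rc (nrm (gamma x)) != 0 by rewrite rc_eq0 nrm_eq0 g0.
  have := hu x hx; rewrite {1}(ht x hx) => /(mulfI nx) e.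
  by rewrite expiD e expiN mulfV // expi_neq0.
have p0 : 2 * pi != 0 :> R by rewrite mulf_neq0 // gt_eqF // pi_gt0.
move=> h; apply/eqP; rewrite -(eqr_int R) -(inj_eq (mulfI p0)); apply/eqP; lra.
Qed.

Lemma windM gamma delta n m : wind gamma n -> wind delta m ->
  wind (fun phi => gamma phi * delta phi) (n + m).
Proof.
move=> [t [ct ht et]] [u [cu hu eu]]; exists (fun x => t x + u x); split.
- by cts.
- move=> phi h; rewrite {1}(ht _ h) {1}(hu _ h) nrmM rcM expiD; ring.
- by rewrite et eu intrD; ring.
Qed.

Lemma wind_cst (c : CC R) : c != 0 -> wind (fun=> c) 0.
Proof.
move=> /polar_exists[t ct]; exists (fun=> t); split=> //; first by cts.
by rewrite mulr0 addr0.
Qed.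

Lemma wind_expi n : wind (fun phi => expi phi ^ n) n.
Proof.
exists (fun phi => n%:~R * phi); split; first by cts.
  by move=> phi _; rewrite expiXz nrm_expi rc1 mul1r.
by rewrite mulr0 add0r mulrC.
Qed.

(** Choose one argument over the whole rectangle. Its increment along the loop at time t is
    continuous in t with values in 2 pi Z, hence constant. *)
Lemma wind_homotopy (H : R * R -> CC R) : continuous H ->
  (forall t phi : R, 0 <= t <= 1 -> 0 <= phi <= 2 * pi -> H (t, phi) != 0) ->
  (forall t : R, 0 <= t <= 1 -> H (t, 0) = H (t, 2 * pi)) ->
  exists2 n, wind (fun phi => H (0, phi)) n & wind (fun phi => H (1, phi)) n.
Proof.
move=> cH Hn0 Hloop.
pose K : set (R * R) := `[0, 1]%classic `*` `[0, 2 * pi]%classic.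
have KP t phi : 0 <= t <= 1 -> 0 <= phi <= 2 * pi -> K (t, phi).
  by move=> ht hp; split=> /=; rewrite in_itv.
have cK : compact K by apply: compact_setX; exact: segment_compact.
(* The rectangle is star-shaped about its corner (0, 0); scaling by [s] supplies the contraction. *)
have [||s [t phi] /andP[s0 s1] [/= ht hp]|theta cth hth] :=
    @argument_lift R _ K (fun p => H (p.1 * p.2.1, p.1 * p.2.2)) (H (0, 0)) cK.
- by cts.
- by move=> x; rewrite /= !mul0r.
- rewrite !in_itv /= in ht hp; case/andP: ht => t0 t1; case/andP: hp => p0 p1.
  apply: Hn0; rewrite mulr_ge0 //=; first by rewrite mulr_ile1.
  by apply: le_trans p1; rewrite ler_piMl.
have hth' t phi : 0 <= t <= 1 -> 0 <= phi <= 2 * pi ->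
    H (t, phi) = rc (nrm (H (t, phi))) * expi (theta (t, phi)).
  by move=> ht hp; have := hth (t, phi) (KP _ _ ht hp); rewrite /= !mul1r.
have cphi t : 0 <= t <= 1 -> continuous (fun phi => theta (t, clamp 0 (2 * pi) phi)).
  move=> ht phi; apply: (@ct_comp _ _ _ theta (fun phi => (t, clamp 0 (2 * pi) phi))).
    by cts; apply: ct_clamp; cts.
  by apply: cth; apply: KP => //; apply: clamp_range; exact: ge0_2pi.
have r0 : 0 <= (0 : R) <= 2 * pi by rewrite lexx ge0_2pi.
have r1 : 0 <= 2 * (pi : R) <= 2 * pi by rewrite lexx ge0_2pi.
have ct phi : 0 <= phi <= 2 * pi -> continuous (fun t => theta (clamp 0 1 t, phi)).
  move=> hp t; apply: (@ct_comp _ _ _ theta (fun t => (clamp 0 1 t, phi))).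
    by cts; apply: ct_clamp; cts.
  by apply: cth; apply: KP => //; apply: clamp_range.
pose w t := theta (clamp 0 1 t, 2 * pi) - theta (clamp 0 1 t, 0).
have w1 t : 0 <= t <= 1 -> expi (w t) = 1.
  move=> ht; rewrite /w clamp_id //.
  have nx : rc (nrm (H (t, 0))) != 0 by rewrite rc_eq0 nrm_eq0 Hn0.
  have := hth' t _ ht r1; rewrite -Hloop // {1}(hth' t _ ht r0) => /(mulfI nx) e.
  by rewrite expiD -e expiN mulfV // expi_neq0.
have z01 : 0 <= (0 : R) <= 1 by rewrite lexx ler01.
have o01 : 0 <= (1 : R) <= 1 by rewrite lexx ler01.
have w01 : w 0 = w 1.
  apply: expi_const => //; rewrite /w => t.
  by apply: ctD; [exact: ct | apply: ctN; exact: ct].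
have [n wn] := expi_eq1 (w1 0 z01).
have main t : 0 <= t <= 1 -> w t = 2 * pi * n%:~R -> wind (fun phi => H (t, phi)) n.
  move=> ht; rewrite /w clamp_id // => e.
  exists (fun phi => theta (t, clamp 0 (2 * pi) phi)); split.
  - exact: cphi.
  - by move=> phi hp; rewrite clamp_id // -hth'.
  - by rewrite !clamp_id // -e addrC subrK.
by exists n; apply: main; rewrite // -?w01.
Qed.

Lemma wind_exists gamma : continuous gamma ->
  (forall phi, 0 <= phi <= 2 * pi -> gamma phi != 0) -> gamma 0 = gamma (2 * pi) ->
  exists n, wind gamma n.
Proof.
move=> cg g0 gl; have [|t phi _|//|n wn _] := @wind_homotopy (fun p => gamma p.2).
- by cts.
- exact: g0.
- by exists n.
Qed.

Lemma has_winding_global gamma n : has_winding gamma n ->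
  exists G : R * R -> CC R, [/\ continuous G, forall p, G p != 0,
    forall t, G (t, 0) = G (t, 2 * pi),
    forall phi, 0 <= phi <= 2 * pi -> G (0, phi) = gamma phi &
    forall phi, 0 <= phi <= 2 * pi -> G (1, phi) = expi phi ^ n].
Proof.
move=> [H [cH [Hn0 [Hl [H0 H1]]]]].
have h2 := ge0_2pi.
have it (t : R) : clamp 0 1 t \in `[0, 1]%R :> bool by rewrite in_itv /= clamp_range.
have ip (phi : R) : clamp 0 (2 * pi) phi \in `[0, (2 * pi : R)]%R :> bool.
  by rewrite in_itv /= clamp_range.
exists (fun p => H (clamp 0 1 p.1) (clamp 0 (2 * pi) p.2)); split.
- apply: (within_continuous_comp_in
    (r := fun p : R * R => (clamp 0 1 p.1, clamp 0 (2 * pi) p.2)) cH).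
    by cts; apply: ct_clamp; cts.
  by move=> p; split=> /=; [exact: it | exact: ip].
- by move=> p; apply: Hn0; [exact: it | exact: ip].
- by move=> t; rewrite /= [clamp 0 (2 * pi) 0]clamp_id ?lexx //
    [clamp 0 (2 * pi) (2 * pi)]clamp_id ?lexx ?h2 // Hl.
- by move=> phi hp; rewrite /= clamp_id ?lexx ?ler01 // clamp_id // H0 // in_itv.
- by move=> phi hp; rewrite /= clamp_id ?lexx ?ler01 // clamp_id // H1 // in_itv.
Qed.

(** Linear deformation in polar coordinates, the modulus to 1 and the angle to n phi. Both angles
    gain 2 pi n along the loop, so every intermediate loop closes. *)
Lemma wind_has_winding gamma n : continuous gamma ->
  (forall phi, 0 <= phi <= 2 * pi -> gamma phi != 0) -> gamma 0 = gamma (2 * pi) ->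
  wind gamma n -> has_winding gamma n.
Proof.
move=> cg g0 gl [th [cth hth e]].
exists (fun t phi => rc ((1 - t) * nrm (gamma phi) + t) *
                     expi ((1 - t) * th phi + t * (n%:~R * phi))).
split; first by apply: continuous_subspaceT; cts.
split.
  move=> t phi; rewrite !in_itv /= => /andP[t0 t1] hp.
  rewrite mulf_neq0 ?expi_neq0 // rc_eq0 gt_eqF //.
  have := g0 _ hp; rewrite -nrm_gt0 => h.
  have [->|/eqP tn0] := eqVneq t 0; first by rewrite subr0 mul1r addr0.
  by rewrite ltr_wpDl ?mulr_ge0 ?subr_ge0 ?nrm_ge0 // lt_def t0 andbT; apply/eqP.
split.
  move=> t _; rewrite -gl e mulr0 mulr0 addr0; congr (_ * _).
  have -> : (1 - t) * (th 0 + 2 * pi * n%:~R) + t * (n%:~R * (2 * pi)) =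
    (1 - t) * th 0 + n%:~R * (2 * pi) by ring.
  by rewrite expiD -(expiXz _ n) expi2pi exp1rz mulr1.
split=> phi; rewrite in_itv /= => hp.
  by rewrite !subr0 !mul1r mul0r !addr0 -hth.
by rewrite subrr !mul0r !add0r !mul1r expiXz.
Qed.

End Winding.

(** * Lifting homotopies on the sphere to C^2 minus the origin *)

Section HopfLift.
Context {R : realType}.
Implicit Types (y : Cbar R) (z a b : CC R).

(* [(a, b)] lies on the complex line of C^2 that [y] stands for in the identification
   of the sphere with the projective line. *)
Definition on_line y a b : Prop := if y is Some z then a = z * b else b = 0.

(* The entries of the orthogonal projector of C^2 onto the line [y]. *)
Definition pr11 y : CC R :=
  if y is Some z then rc (nrm z ^+ 2 / (1 + nrm z ^+ 2)) else 1.
Definition pr12 y : CC R := if y is Some z then z * rc (1 + nrm z ^+ 2)^-1 else 0.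
Definition pr22 y : CC R := if y is Some z then rc (1 + nrm z ^+ 2)^-1 else 0.

Lemma nrm_den_gt0 z : 0 < 1 + nrm z ^+ 2.
Proof. by rewrite ltr_pwDl // sqr_ge0. Qed.

Lemma nrm_denV_ge0 z : 0 <= (1 + nrm z ^+ 2)^-1.
Proof. by rewrite invr_ge0 ltW // nrm_den_gt0. Qed.

(** Approach to the value at infinity at rate 1/|z| is enough, and the projector entries have this
    rate. *)
Lemma continuous_Cbar (h : Cbar R -> CC R) (B : R) : 0 <= B ->
  continuous (fun z : CC R => h (Some z)) ->
  (forall z, 1 < nrm z -> nrm (h (Some z) - h None) * nrm z <= B) -> continuous h.
Proof.
move=> B0 ch hb.
suff hN : continuous_at (None : Cbar R) h by case=> [z|//] W /(ch z).
apply: ct_dist => k k0.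
apply: (@filterS _ (nbhs (None : Cbar R)) _ _ _ _ (near_infty (1 + B / k))).
move=> [z|] /=; last by rewrite subrr nrm0.
move=> zk; have Bk : 0 <= B / k by rewrite divr_ge0 // ltW.
have z1 : 1 < nrm z by apply: le_lt_trans zk; rewrite lerDl.
have z0 : 0 < nrm z by apply: lt_trans z1.
rewrite -(ltr_pM2r z0); apply: le_lt_trans (hb z z1) _.
by rewrite mulrC -ltr_pdivrMr //; apply: le_lt_trans zk; rewrite lerDr.
Qed.

Lemma continuous_pr11 : continuous pr11.
Proof.
apply: (continuous_Cbar ler01) => [|z z1] /=; first by cts; rewrite gt_eqF // nrm_den_gt0.
have -> : rc (nrm z ^+ 2 / (1 + nrm z ^+ 2)) - 1 = rc (- (1 + nrm z ^+ 2)^-1).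
  by rewrite -rc1 -rcB; congr rc; field; rewrite gt_eqF // nrm_den_gt0.
rewrite nrm_real normrN ger0_norm ?nrm_denV_ge0 //.
by rewrite mulrC ler_pdivrMr ?nrm_den_gt0 //; nra.
Qed.

Lemma continuous_pr12 : continuous pr12.
Proof.
apply: (continuous_Cbar ler01) => [|z z1] /=; first by cts; rewrite gt_eqF // nrm_den_gt0.
rewrite subr0 nrmM nrm_real ger0_norm ?nrm_denV_ge0 //.
by rewrite mulrAC ler_pdivrMr ?nrm_den_gt0 //; nra.
Qed.

Lemma continuous_pr22 : continuous pr22.
Proof.
apply: (continuous_Cbar ler01) => [|z z1] /=; first by cts; rewrite gt_eqF // nrm_den_gt0.
rewrite subr0 nrm_real ger0_norm ?nrm_denV_ge0 //.
by rewrite mulrC ler_pdivrMr ?nrm_den_gt0 //; nra.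
Qed.

(** The projector of [y] applied to (a, b); it is Hermitian, so its lower left entry is the
    conjugate of [pr12]. *)
Definition line_proj1 y a b := pr11 y * a + pr12 y * b.
Definition line_proj2 y a b := Num.conj (pr12 y) * a + pr22 y * b.

Lemma conj_rc (x : R) : Num.conj (rc x) = rc x.
Proof. by rewrite conjE /= oppr0. Qed.

Lemma conj_mul a b : Num.conj (a * b) = Num.conj a * Num.conj b.
Proof. exact: rmorphM. Qed.

Lemma conj_inv a : Num.conj a^-1 = (Num.conj a)^-1.
Proof. exact: fmorphV. Qed.

Lemma on_line_proj y a b : on_line y (line_proj1 y a b) (line_proj2 y a b).
Proof.
case: y => [z|] /=; rewrite /line_proj1 /line_proj2 /=; last by rewrite conjC0 !mul0r addr0.
rewrite conj_mul conj_rc rcM rcX.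
have -> : rc (nrm z) ^+ 2 = z * Num.conj z by rewrite mul_conj rcX.
ring.
Qed.

(** The projector has rank one: both of its columns lie on the line spanned by (a, b). *)
Lemma pr_columns y a b : on_line y a b -> ~ (a = 0 /\ b = 0) ->
  exists s t, [/\ pr11 y = a * s, Num.conj (pr12 y) = b * s,
                  pr12 y = a * t & pr22 y = b * t].
Proof.
case: y => [z|] /= h n0; last first.
  have a0 : a != 0 by apply/eqP => a0; apply: n0.
  by exists a^-1, 0; rewrite h mulfV // conjC0 mul0r !mulr0.
have b0 : b != 0.
  by apply/eqP => b0; apply: n0; rewrite h b0 mulr0.
exists (Num.conj z * rc (1 + nrm z ^+ 2)^-1 / b), (rc (1 + nrm z ^+ 2)^-1 / b).
rewrite h conj_mul conj_rc rcM -mul_conj.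
by move: (rc _) => v; split; field.
Qed.

(* Trace of the product of two projectors: it vanishes iff the lines are orthogonal. *)
Definition overlap y y' : R :=
  re (pr11 y' * pr11 y + pr12 y' * Num.conj (pr12 y) +
      (Num.conj (pr12 y') * pr12 y + pr22 y' * pr22 y)).

Lemma overlap_diag y : 0 < overlap y y.
Proof.
rewrite /overlap /pr11 /pr12 /pr22; case: y => [z|].
  rewrite [X in _ + (X + _)]mulrC mul_conj -!rcM -!rcD re_rc.
  have v0 := nrm_denV_ge0 z.
  rewrite ltr_wpDl // ?addr_ge0 -?expr2 ?sqr_ge0 //.
  by rewrite ltr_wpDl ?sqr_ge0 // exprn_gt0 // invr_gt0 nrm_den_gt0.
by rewrite conjC0 !mul0r mulr1 !addr0 ltr01.
Qed.

(** If the projector of y' killed (a, b), it would kill the columns of the projector of y, and the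
    trace of the product would be 0. *)
Lemma proj_neq0 y y' a b : on_line y a b -> ~ (a = 0 /\ b = 0) -> 0 < overlap y y' ->
  ~ (line_proj1 y' a b = 0 /\ line_proj2 y' a b = 0).
Proof.
move=> l n0 ov [h1 h2]; have [s [t [e1 e2 e3 e4]]] := pr_columns l n0.
move: ov; rewrite /overlap e2 e1 e3 e4.
have -> : pr11 y' * (a * s) + pr12 y' * (b * s) +
    (Num.conj (pr12 y') * (a * t) + pr22 y' * (b * t)) =
    line_proj1 y' a b * s + line_proj2 y' a b * t by rewrite /line_proj1 /line_proj2; ring.
by rewrite h1 h2 !mul0r addr0 ltxx.
Qed.

(** Start from a constant vector on [y0] and project it at each time step onto the next line.
    Consecutive lines are never orthogonal when the subdivision is fine, so the vector stays nonzero
    over [K]. *)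
Lemma hopf_lift (X : topologicalType) (K : set X) (G : R * X -> Cbar R) y0 :
  compact K -> continuous G -> (forall x, G (0, x) = y0) ->
  exists A B : X -> CC R, [/\ continuous A, continuous B &
    forall x, K x -> on_line (G (1, x)) (A x) (B x) /\ ~ (A x = 0 /\ B x = 0)].
Proof.
move=> cK cG G0.
have c1 := continuous_pr11; have c2 := continuous_pr12; have c3 := continuous_pr22.
have [|s x _ _|N N0 step] :=
  @diagonal_steps R X K (fun p => overlap (G (p.1, p.2.2)) (G (p.2.1, p.2.2))) cK.
- by rewrite /overlap; cts.
- exact: overlap_diag.
suff h m : (m <= N)%N -> exists A B : X -> CC R, [/\ continuous A, continuous B &
    forall x, K x -> on_line (G (m%:R / N%:R, x)) (A x) (B x) /\ ~ (A x = 0 /\ B x = 0)].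
  by have := h N (leqnn N); rewrite divff // pnatr_eq0 -lt0n.
elim: m => [_|m IH mN].
  case: y0 G0 => [z|] G0.
    exists (fun=> z), (fun=> 1); split; [by cts | by cts |].
    move=> x _; rewrite mul0r G0 /= mulr1; split=> //.
    by case=> _ /eqP; rewrite oner_eq0.
  exists (fun=> 1), (fun=> 0); split; [by cts | by cts |].
  move=> x _; rewrite mul0r G0 /=; split=> //.
  by case=> /eqP; rewrite oner_eq0.
have [A [B [cA cB AB]]] := IH (ltnW mN).
pose g x := G (m.+1%:R / N%:R, x).
have cg : continuous g by rewrite /g; cts.
exists (fun x => line_proj1 (g x) (A x) (B x)), (fun x => line_proj2 (g x) (A x) (B x)).
rewrite /line_proj1 /line_proj2; split; [by cts | by cts |].
move=> x Kx; have [l n0] := AB x Kx; split; first exact: on_line_proj.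
by apply: (proj_neq0 l n0); exact: (step m x mN Kx).
Qed.

End HopfLift.

(** * The standard maps of different degrees are not homotopic *)

Section DegreeInvariance.
Context {R : realType}.
Implicit Types (z w : CC R) (d : int).

Definition disc1 : set (CC R) := [set z | nrm z <= 1].

(** Shrinking the unit circle to the centre of the disc deforms the loop to a constant one without
    meeting 0. *)
Lemma wind_disc (F : CC R -> CC R) (u : R -> CC R) : continuous F -> continuous u ->
  (forall z, disc1 z -> F z != 0) -> (forall phi, nrm (u phi) = 1) ->
  u 0 = u (2 * pi) -> wind (fun phi => F (u phi)) 0.
Proof.
move=> cF cu F0 u1 ul.
have d1 t phi : 0 <= t <= 1 -> disc1 (rc t * u phi).
  by move=> /andP[t0 t1]; rewrite /disc1 /= nrm_real_mul // u1 mulr1.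
have [|t phi ht _|t _|n w0 w1] := @wind_homotopy R (fun p => F (rc p.1 * u p.2)).
- by cts.
- by apply: F0; exact: d1.
- by rewrite /= ul.
have e0 phi : 0 <= phi <= 2 * pi -> F (rc 0 * u phi) = F 0.
  by move=> _; rewrite rc0 mul0r.
have F00 : F 0 != 0 by apply: F0; rewrite /disc1 /= nrm0.
rewrite (wind_unique _ (wind_cst F00) (wind_eq e0 w0)) //.
by apply: wind_eq w1 => phi _; rewrite /= rc1 mul1r.
Qed.

(** The finite part of [std_map]. For negative [d] the conjugate power agrees with z^d on the unit
    circle but has no pole. *)
Definition pw d z : CC R := if 0 <= d then z ^+ absz d else (Num.conj z) ^+ absz d.

Lemma pw_expi d phi : pw d (expi phi) = expi phi ^ d.
Proof.
rewrite /pw; case: d => d /=; first by rewrite exprnP.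
by rewrite conj_expi expiN exprVn NegzE exprnN.
Qed.

Lemma conj_pw d z : Num.conj (pw d z) = pw d (Num.conj z).
Proof. by rewrite /pw; case: ifP => _; exact: rmorphXn. Qed.

Lemma pwV d z : pw d z^-1 = (pw d z)^-1.
Proof. by rewrite /pw; case: ifP => _; rewrite ?conj_inv exprVn. Qed.

Lemma pw_neq0 d z : z != 0 -> pw d z != 0.
Proof. by move=> z0; rewrite /pw; case: ifP => _; rewrite expf_neq0 // fmorph_eq0. Qed.

Lemma continuous_pw d : continuous (pw d).
Proof. by rewrite /pw; case: (0 <= d); cts. Qed.

(** Two nonzero vectors of one complex line are proportional, so their Hermitian product cannot
    vanish. *)
Lemma on_line_inner (y : Cbar R) a b a' b' :
  on_line y a b -> ~ (a = 0 /\ b = 0) -> on_line y a' b' -> ~ (a' = 0 /\ b' = 0) ->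
  a * Num.conj a' + b * Num.conj b' != 0.
Proof.
case: y => [z|] /= h n0 h' n0'; last first.
  rewrite h h' mul0r addr0 mulf_neq0 ?fmorph_eq0 //.
    by apply/eqP => a0; apply: n0.
  by apply/eqP => a0; apply: n0'.
have b0 : b != 0 by apply/eqP => b0; apply: n0; rewrite h b0 mulr0.
have b0' : b' != 0 by apply/eqP => b0'; apply: n0'; rewrite h' b0' mulr0.
have -> : a * Num.conj a' + b * Num.conj b' =
    b * Num.conj b' * rc (1 + nrm z ^+ 2).
  by rewrite h h' conj_mul rcD -mul_conj rc1; ring.
apply: mulf_neq0; first by apply: mulf_neq0; rewrite ?fmorph_eq0.
by rewrite rc_eq0 gt_eqF // nrm_den_gt0.
Qed.

(* The clutching function of the standard map: the lifts over the two discs have no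
   zero in the second, resp. first, coordinate, which therefore do not wind. *)
Lemma wind_std_clutching d (A B A' B' : CC R -> CC R) :
  continuous A -> continuous B -> continuous A' -> continuous B' ->
  (forall z, disc1 z -> on_line (std_map d (Some z)) (A z) (B z) /\ ~ (A z = 0 /\ B z = 0)) ->
  (forall w, disc1 w ->
     on_line (std_map d (quot 1 w)) (A' w) (B' w) /\ ~ (A' w = 0 /\ B' w = 0)) ->
  wind (fun phi => A (expi phi) * Num.conj (A' (expi (- phi))) +
                   B (expi phi) * Num.conj (B' (expi (- phi)))) d.
Proof.
move=> cA cB cA' cB' AB AB'.
have hA z : disc1 z -> A z = pw d z * B z by move=> /AB[].
have hB z : disc1 z -> B z != 0.
  by move=> dz; have [_ n0] := AB z dz; apply/eqP => b0; apply: n0; rewrite hA // b0 mulr0.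
have hB' w : disc1 w -> B' w = pw d w * A' w.
  move=> /AB'[]; rewrite /quot; case: (eqVneq w 0) => [->|w0] /=.
    (* w = 0 is the point at infinity, which [std_map] sends to 1 if d = 0 and fixes otherwise. *)
    rewrite /pw; case: (eqVneq d 0) => [->|d0] /= h _; first by rewrite h expr0 !mul1r.
    by rewrite h conjC0 if_same expr0n absz_eq0 (negbTE d0) mul0r.
  rewrite mul1r -/(pw d w^-1) pwV => -> _.
  by rewrite mulrA mulfV ?mul1r // pw_neq0.
have hA' w : disc1 w -> A' w != 0.
  by move=> dw; have [_ n0] := AB' w dw; apply/eqP => a0; apply: n0; rewrite hB' // a0 mulr0.
have d1 (phi : R) : disc1 (expi phi) by rewrite /disc1 /= nrm_expi.
have e2 : expi (- (2 * pi)) = expi (- 0) :> CC R by rewrite oppr0 expiN expi2pi expi0 invr1.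
have w1 : wind (fun phi => B (expi phi)) 0.
  apply: wind_disc => //; [by cts | by move=> phi; rewrite nrm_expi |].
  by rewrite expi0 expi2pi.
have w2 : wind (fun phi => Num.conj (A' (expi (- phi)))) 0.
  apply: (@wind_disc (fun w => Num.conj (A' w)) (fun phi => expi (- phi))).
  - by cts.
  - by cts.
  - by move=> z dz; rewrite fmorph_eq0 hA'.
  - by move=> phi; rewrite nrm_expi.
  - by rewrite e2.
(* On the equator the two terms of the inner product are equal, whence the factor 2. *)
have w3 : wind (fun=> 2 : CC R) 0 by apply: wind_cst; rewrite pnatr_eq0.
have := windM (windM (windM w3 (wind_expi d)) w1) w2.
rewrite add0r !addr0; apply: wind_eq => phi _.
rewrite hA ?hB' // conj_mul conj_pw conj_expi opprK pw_expi; ring.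
Qed.

Lemma std_map_homotopic_inj (d d' : int) :
  homotopic R (@std_map R d) (@std_map R d') -> d = d'.
Proof.
move=> /homotopicP[H [cH H0 H1]].
pose K : set (R * CC R) := `[0, 1]%classic `*` disc1.
have cK : compact K by apply: compact_setX; [exact: segment_compact | exact: compact_disc].
have lift (kap : CC R -> Cbar R) : continuous kap ->
    exists A B : R * CC R -> CC R, [/\ continuous A, continuous B &
      forall t z, 0 <= t <= 1 -> disc1 z ->
        on_line (H (t, kap z)) (A (t, z)) (B (t, z)) /\ ~ (A (t, z) = 0 /\ B (t, z) = 0)].
  move=> ck.
  have [||A [B [cA cB AB]]] := @hopf_lift R _ K
    (fun p => H (p.1 * p.2.1, kap (rc p.1 * p.2.2))) (H (0, kap 0)) cK.
  - by cts.
  - by move=> x; rewrite /= !mul0r.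
  exists A, B; split; [exact: cA | exact: cB |] => t z ht dz.
  have Ktz : K (t, z) by split=> //=; rewrite in_itv.
  have := AB (t, z) Ktz; rewrite /= mul1r rc1 mul1r => ABtz; exact: ABtz.
have cSome : continuous (fun z : CC R => Some z : Cbar R).
  by move=> z; apply: ct_Some; cts.
have cinv : continuous (fun w : CC R => quot 1 w).
  move=> w; apply: ct_quot; [by cts | by cts |].
  by case=> /eqP; rewrite oner_eq0.
have [A [B [cA cB AB]]] := lift _ cSome.
have [A' [B' [cA' cB' AB']]] := lift _ cinv.
have d1 (phi : R) : disc1 (expi phi) by rewrite /disc1 /= nrm_expi.
(* The second hemisphere has the coordinate w = 1/z, so an equatorial point e^{i phi} is e^{-i phi}
   there. *)
pose c (p : R * R) := A (p.1, expi p.2) * Num.conj (A' (p.1, expi (- p.2))) +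
                      B (p.1, expi p.2) * Num.conj (B' (p.1, expi (- p.2))).
have n0 t : 0 <= t <= 1 -> forall phi, 0 <= phi <= 2 * pi -> c (t, phi) != 0.
  move=> ht phi _.
  have [l n0] := AB t _ ht (d1 phi); have [l' n0'] := AB' t _ ht (d1 (- phi)).
  apply: on_line_inner l n0 _ n0'; move: l'.
  by rewrite /quot (negbTE (expi_neq0 _)) mul1r expiN invrK.
have [|t phi ht hp|t _|n w0 w1] := @wind_homotopy R c.
- by rewrite /c; cts.
- exact: n0.
- by rewrite /c /= oppr0 expiN expi2pi expi0 invr1.
have z01 : 0 <= (0 : R) <= 1 by rewrite lexx ler01.
have o01 : 0 <= (1 : R) <= 1 by rewrite lexx ler01.
have std t e : 0 <= t <= 1 -> (forall y, H (t, y) = std_map e y) ->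
    wind (fun phi => c (t, phi)) e.
  move=> ht Ht; apply: (@wind_std_clutching e (fun z => A (t, z)) (fun z => B (t, z))
    (fun z => A' (t, z)) (fun z => B' (t, z))); [by cts|by cts|by cts|by cts| |].
  - by move=> z dz; rewrite -Ht; exact: AB.
  - by move=> w dw; rewrite -Ht; exact: AB'.
rewrite (wind_unique (n0 0 z01) (std 0 d z01 H0) w0).
by rewrite (wind_unique (n0 1 o01) (std 1 d' o01 H1) w1).
Qed.

End DegreeInvariance.

(** * General position: perturbing a pair so that three real functions have no common zero *)

Section LipschitzApproximation.
Context {R : realType}.
Implicit Types (a : CC R -> R) (z w : CC R).

Definition lipschitz_with (L : R) a := forall z w, `|a z - a w| <= L * nrm (z - w).

Lemma continuous_lipschitz L a : lipschitz_with L a -> continuous a.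
Proof.
move=> La z; apply: ct_distR => e e0.
have : continuous_at z (fun w => L * nrm (z - w)) by cts.
move=> /(@ct_lt _ _ _ _ e); rewrite subrr nrm0 mulr0 => /(_ e0).
by apply: filterS => w; apply: le_lt_trans.
Qed.

(** The pairs whose values differ by at least [e] form a compact set off the diagonal, on which the
    distance has a positive lower bound. *)
Lemma uniform_continuity_disc a (r e : R) : continuous a -> 0 < e ->
  exists2 d : R, 0 < d & forall z w, nrm z <= r -> nrm w <= r -> nrm (z - w) < d ->
    `|a z - a w| < e.
Proof.
move=> ca e0.
pose D : set (CC R) := [set z | nrm z <= r].
pose S : set (CC R * CC R) := (D `*` D) `&` [set p | e <= `|a p.1 - a p.2|].
have cS : compact S.
  apply: compact_closedI; first by apply: compact_setX; exact: compact_disc.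
  apply: (@closed_comp _ _ _ [set x : R | e <= x]); last exact: closed_ge.
  by move=> p _; cts.
have [||d d0 dS] := @compact_lower_bound R _ S (fun p => nrm (p.1 - p.2)) cS.
- by cts.
- move=> [z w] [_ /= ezw]; rewrite nrm_gt0 subr_eq0; apply/eqP => zw.
  by move: ezw; rewrite zw subrr normr0 leNgt e0.
exists d => // z w zr wr zw; rewrite ltNge; apply/negP => ezw.
by have := dS (z, w) (conj (conj zr wr) ezw); rewrite leNgt zw.
Qed.

(* The infimal convolution [z |-> inf_w (a w + L |z - w|)] is L-Lipschitz and close to
   [a] on the disc for L large. *)
Lemma lipschitz_approximation a (r e : R) : continuous a -> 0 < e -> 0 <= r ->
  exists L a', [/\ 0 <= L, lipschitz_with L a' &
    forall z, nrm z <= r -> `|a' z - a z| <= e].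
Proof.
move=> ca e0 r0.
have [d d0 ud] := uniform_continuity_disc r ca e0.
have [B B0 aB] := compact_upper_bound (@compact_disc R r) ca.
(* Beyond distance [d] the penalty is at least 2 B, which bounds the oscillation of [a] on the disc;
   within [d] uniform continuity applies. *)
pose L := 2 * B / d; have L0 : 0 <= L by rewrite divr_ge0 ?mulr_ge0 // ltW.
pose E z : set R := [set a w + L * nrm (z - w) | w in [set w | nrm w <= r]].
have Ene z : E z !=set0 by exists (a 0 + L * nrm (z - 0)); exists 0 => //=; rewrite nrm0.
have Elb z : has_lbound (E z).
  exists (- B) => _ [w /= wr <-]; rewrite -[- B]addr0 lerD //.
    by have := aB w wr; rewrite ler_norml => /andP[].
  by rewrite mulr_ge0 // nrm_ge0.
have step z w : inf (E z) <= inf (E w) + L * nrm (z - w).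
  rewrite -lerBlDr; apply: lb_le_inf => // _ [v /= vr <-].
  rewrite lerBlDr; apply: le_trans (_ : a v + L * nrm (z - v) <= _).
    by apply: ge_inf => //; exists v.
  rewrite -addrA lerD2l -mulrDr ler_wpM2l //.
  have -> : z - v = (w - v) + (z - w) by ring.
  exact: nrmD.
exists L, (fun z => inf (E z)); split=> // [z w|z zr].
  rewrite ler_norml; apply/andP; split; last by rewrite lerBlDl addrC; have := step z w; lra.
  by have := step w z; rewrite -nrmN opprB; lra.
have h1 : inf (E z) <= a z.
  by apply: ge_inf => //; exists z => //; rewrite subrr nrm0 mulr0 addr0.
have h2 : a z - e <= inf (E z).
  apply: lb_le_inf => // _ [w /= wr <-].
  have [zw|zw] := ltP (nrm (z - w)) d.
    have := ud z w zr wr zw; rewrite ltr_norml => /andP[_ h].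
    have : 0 <= L * nrm (z - w) by rewrite mulr_ge0 // nrm_ge0.
    by lra.
  have : 2 * B <= L * nrm (z - w).
    by rewrite /L mulrAC ler_pdivlMr // ler_wpM2l // mulr_ge0 // ltW.
  have := aB z zr; have := aB w wr; rewrite !ler_norml => /andP[? ?] /andP[? ?].
  by lra.
by rewrite ler_norml; apply/andP; split; lra.
Qed.

(* A Lipschitz image of a disc in R^3 has measure zero: m^6 points of a grid of step
   e / m^2 cannot all be hit, as two preimages would share one of (m^3 - 1)^2 cells. *)
Lemma lipschitz_avoid a b c (L r e : R) :
  lipschitz_with L a -> lipschitz_with L b -> lipschitz_with L c -> 0 <= L ->
  0 < r -> 0 < e ->
  exists u v w : R, [/\ 0 <= u <= e, 0 <= v <= e, 0 <= w <= e &
    forall z, nrm z <= r -> ~ [/\ a z = u, b z = v & c z = w]].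
Proof.
move=> La Lb Lc L0 r0 e0; apply: contrapT => hit.
(* Large enough that a coordinate varies over one cell by at most 4 r L / q, less than the grid step
   e / m^2. *)
pose m := (Num.trunc (8 * r * L / e)).+2.
have mL : 8 * r * L < e * m%:R.
  rewrite [e * _]mulrC -ltr_pdivrMr //; apply: lt_trans (truncnS_gt _) _.
  by rewrite ltr_nat.
have m2 : (2 <= m)%N by [].
(* [k] grid values per coordinate. Each side of the square is cut into [q] intervals, and the right
   end point takes an index of its own, giving q + 1 = m^3 - 1 indices. *)
pose k := (m ^ 2)%N; pose q := (m ^ 3 - 2)%N.
have m38 : (8 <= m ^ 3)%N by rewrite -[8%N]/(2 ^ 3)%N leq_exp2r.
have k0 : 0 < (k%:R : R) by rewrite ltr0n expn_gt0.
have q0 : 0 < (q%:R : R) by rewrite ltr0n subn_gt0 (leq_trans _ m38).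
have qE : (q%:R : R) = m%:R ^+ 3 - 2 by rewrite natrB ?natrX // (leq_trans _ m38).
pose s : R := q%:R / (2 * r).
have s0 : 0 < s by rewrite divr_gt0 // mulr_gt0.
pose T := ('I_k * 'I_k * 'I_k)%type.
pose co (i : 'I_k) : R := e * i%:R / k%:R.
have co_range i : 0 <= co i <= e.
  rewrite /co divr_ge0 ?mulr_ge0 ?(ltW e0) ?(ltW k0) //= ler_pdivrMr //.
  by rewrite ler_wpM2l ?(ltW e0) // ler_nat ltnW.
have /choice[Z hZ] : forall t : T, exists z,
    nrm z <= r /\ [/\ a z = co t.1.1, b z = co t.1.2 & c z = co t.2].
  move=> t; apply: contrapT => hz; apply: hit.
  exists (co t.1.1), (co t.1.2), (co t.2); split=> // z zr abc.
  by apply: hz; exists z.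
pose cell (x : R) : 'I_q.+1 := inord (Num.trunc ((x + r) * s)).
have cellP x y : `|x| <= r -> `|y| <= r -> cell x = cell y -> `|x - y| <= s^-1.
  have bd u : `|u| <= r -> 0 <= (u + r) * s /\ (Num.trunc ((u + r) * s) < q.+1)%N.
    rewrite ler_norml => /andP[u1 u2]; split; first by rewrite mulr_ge0 ?(ltW s0) //; lra.
    rewrite ltnS truncn_le_nat; apply: le_lt_trans (_ : (q%:R : R) < _); last by rewrite ltr_nat.
    rewrite /s mulrA ler_pdivrMr ?mulr_gt0 // mulrC ler_wpM2l //; lra.
  move=> /bd[x0 xq] /bd[y0 yq] /(congr1 val); rewrite /= !inordK // => e1.
  have := truncn_itv x0; have := truncn_itv y0; rewrite e1 => /andP[y1 y2] /andP[x1 x2].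
  have h : `|(x - y) * s| <= 1.
    have -> : (x - y) * s = (x + r) * s - (y + r) * s by ring.
    by rewrite ler_norml; move: y2 x2; rewrite -!natr1 => y2 x2; apply/andP; split; lra.
  by move: h; rewrite normrM (gtr0_norm s0) -ler_pdivlMr // div1r.
have co_inj i j : `|co i - co j| <= L * (2 / s) -> i = j.
  move=> h; apply/val_inj/eqP; rewrite -(eqr_nat R) -subr_eq0.
  have bound : L * (2 / s) < e / k%:R.
    have -> : L * (2 / s) = 4 * r * L / q%:R by rewrite /s; field; rewrite !gt_eqF.
    rewrite ltr_pdivrMr // [e / _ * _]mulrAC ltr_pdivlMr // qE /k natrX.
    have M2 : (2 : R) <= m%:R by rewrite ler_nat.
    have mm : 0 <= m%:R ^+ 2 :> R by rewrite sqr_ge0.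
    apply: le_lt_trans (_ : e * m%:R / 2 * m%:R ^+ 2 < _); last first.
      rewrite -subr_gt0; have -> : e * (m%:R ^+ 3 - 2) - e * m%:R / 2 * m%:R ^+ 2 =
        e * (m%:R ^+ 3 / 2 - 2) by field.
      rewrite mulr_gt0 //; have : (8 : R) <= m%:R ^+ 3 by rewrite -natrX ler_nat.
      by lra.
    by rewrite ler_wpM2r //; lra.
  have {h bound} := le_lt_trans h bound.
  have -> : co i - co j = (e / k%:R) * (i%:R - j%:R) by rewrite /co; field; rewrite gt_eqF.
  rewrite normrM gtr0_norm ?divr_gt0 // -[X in _ < X]mulr1 ltr_pM2l ?divr_gt0 //.
  rewrite -[i%:R]/((i : int)%:~R) -[j%:R]/((j : int)%:~R) -intrB -intr_norm.
  by rewrite -[1]/((0 + 1 : int)%:~R) ltr_int intr_eq0 ltzD1 normr_le0.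
pose f (t : T) := (cell (re (Z t)), cell (im (Z t))).
have f_inj : injective f.
  move=> t t' [e1 e2]; have [zr [a1 b1 c1]] := hZ t; have [zr' [a2 b2 c2]] := hZ t'.
  have d1 := cellP _ _ (le_trans (le_re_nrm _) zr) (le_trans (le_re_nrm _) zr') e1.
  have d2 := cellP _ _ (le_trans (le_im_nrm _) zr) (le_trans (le_im_nrm _) zr') e2.
  have d : nrm (Z t - Z t') <= 2 / s.
    apply: le_trans (nrm_le _) _; rewrite reD imD reN imN.
    have -> : 2 / s = s^-1 + s^-1 by ring.
    exact: lerD.
  have Ld : L * nrm (Z t - Z t') <= L * (2 / s) by rewrite ler_wpM2l.
  have i1 := co_inj t.1.1 t'.1.1; rewrite -a1 -a2 in i1.
  have i2 := co_inj t.1.2 t'.1.2; rewrite -b1 -b2 in i2.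
  have i3 := co_inj t.2 t'.2; rewrite -c1 -c2 in i3.
  have {}i1 := i1 (le_trans (La _ _) Ld); have {}i2 := i2 (le_trans (Lb _ _) Ld).
  have {}i3 := i3 (le_trans (Lc _ _) Ld).
  by clear -i1 i2 i3; case: t t' i1 i2 i3 => [[? ?] ?] [[? ?] ?] /= -> -> ->.
have := leq_card f f_inj; rewrite !card_prod !card_ord leqNgt => /negP; apply.
have q1 : (q.+1 < m ^ 3)%N.
  by rewrite /q; case: (m ^ 3)%N m38 => [|[|n]] // _; rewrite !subSS subn0.
by rewrite /k -!expnD -[X in (_ < X)%N]/(m ^ (3 + 3))%N expnD ltn_mul.
Qed.

Definition chi (M : R) z : CC R := rc (clamp 0 1 (2 - nrm z / M)).

Lemma continuous_chi M : continuous (chi M).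
Proof. by move=> z; rewrite /chi; apply: ct_real; apply: ct_clamp; cts. Qed.

Lemma chi_in M z : 0 < M -> nrm z <= M -> chi M z = 1.
Proof.
move=> M0 zM; rewrite /chi clamp_ge ?rc1 // lerBrDl -lerBrDr.
by rewrite ler_pdivrMr //; lra.
Qed.

Lemma chi_out M z : 0 < M -> 2 * M <= nrm z -> chi M z = 0.
Proof.
by move=> M0 zM; rewrite /chi clamp_le ?rc0 // subr_le0 ler_pdivlMr.
Qed.

Lemma chi_range M z : exists2 x : R, 0 <= x <= 1 & chi M z = rc x.
Proof. by exists (clamp 0 1 (2 - nrm z / M)) => //; exact: clamp_range. Qed.

(** A small vector (u, v, w) missed by the Lipschitz approximations of (Re f, Im f, Im g) is
    subtracted from them; Re g is kept. Closeness to the original pair makes the straight segments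
    admissible homotopies. *)
Lemma perturbation (f g : CC R -> CC R) (M : R) :
  continuous f -> continuous g -> (forall z, ~ (f z = 0 /\ g z = 0)) -> 0 < M ->
  (forall z, M <= nrm z -> f z != 0) ->
  exists f' g' : CC R -> CC R, [/\ continuous f', continuous g',
    forall z, nrm z <= M -> f' z = 0 -> im (g' z) != 0,
    forall (t : R) z, 0 <= t <= 1 -> M <= nrm z -> f z + rc t * (f' z - f z) != 0 &
    forall (t : R) z, 0 <= t <= 1 -> nrm z <= M ->
      ~ (f z + rc t * (f' z - f z) = 0 /\ g z + rc t * (g' z - g z) = 0)].
Proof.
move=> cf cg fg M0 f0.
have [|z _|d1 d10 hd1] := @compact_lower_bound R _ _ (fun z => nrm (f z) + nrm (g z))
  (@compact_disc R M).
- by cts.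
- have [fz|fz] := eqVneq (f z) 0; last by rewrite ltr_pwDl ?nrm_gt0 ?nrm_ge0.
  rewrite ltr_wpDl ?nrm_ge0 // nrm_gt0; apply/eqP => gz.
  by apply: (fg z).
have [|z /andP[zM _]|d2 d20 hd2] := @compact_lower_bound R _ _ (fun z => nrm (f z))
  (@compact_annulus R M (2 * M)).
- by cts.
- by rewrite nrm_gt0 f0.
(* On the disc [f] and [g] move by at most 4 e and 2 e, on the annulus [f] by at most 4 e, below the
   lower bounds [d1] and [d2], which are at least 8 e. *)
pose e := Num.min d1 d2 / 8.
have e0 : 0 < e by rewrite divr_gt0 // lt_min d10 d20.
have e1 : 8 * e <= d1 by rewrite /e mulrC divfK // ge_min lexx.
have e2 : 8 * e <= d2 by rewrite /e mulrC divfK // ge_min lexx orbT.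
have M2 : 0 < 2 * M by rewrite mulr_gt0.
have cre : continuous (fun z => re (f z)) by cts.
have cim : continuous (fun z => im (f z)) by cts.
have cimg : continuous (fun z => im (g z)) by cts.
have [La [a [La0 aL ha]]] := lipschitz_approximation cre e0 (ltW M2).
have [Lb [b [Lb0 bL hb]]] := lipschitz_approximation cim e0 (ltW M2).
have [Lc [c [Lc0 cL hc]]] := lipschitz_approximation cimg e0 (ltW M2).
have lipW L L' h : lipschitz_with L h -> L <= L' -> lipschitz_with L' h.
  by move=> hL LL z w; apply: le_trans (hL z w) _; rewrite ler_wpM2r ?nrm_ge0.
have [||||u [v [w [hu hv hw hz]]]] := @lipschitz_avoid a b c (La + Lb + Lc) M e _ _ _ _ M0 e0.
- by apply: lipW aL _; lra.
- by apply: lipW bL _; lra.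
- by apply: lipW cL _; lra.
- by lra.
have ca := continuous_lipschitz aL; have cb := continuous_lipschitz bL.
have cc := continuous_lipschitz cL; have cchi := @continuous_chi M.
pose F z : CC R := ((a z - u) +i* (b z - v))%C.
(* Equal to [F] on the disc of radius M and to [f] beyond 2 M, where the approximations are not
   controlled. *)
pose f' z := f z + chi M z * (F z - f z).
pose g' z : CC R := (re (g z) +i* (c z - w))%C.
have cF : continuous F by rewrite /F; cts.
have near_f z : nrm z <= 2 * M -> nrm (f' z - f z) <= 4 * e.
  move=> zM; rewrite /f' addrC addKr nrmM.
  have [x /andP[x0 x1] ->] := chi_range M z; rewrite nrm_real ger0_norm //.
  apply: le_trans (_ : nrm (F z - f z) <= _); first by rewrite ler_piMl ?nrm_ge0.
  apply: le_trans (nrm_le _) _; rewrite reD imD reN imN /=.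
  have := ha z zM; have := hb z zM; rewrite !ler_norml => /andP[? ?] /andP[? ?].
  case/andP: hu => ? ?; case/andP: hv => ? ?.
  have h1 : `|a z - u - re (f z)| <= 2 * e by rewrite ler_norml; apply/andP; split; lra.
  have h2 : `|b z - v - im (f z)| <= 2 * e by rewrite ler_norml; apply/andP; split; lra.
  by lra.
have near_g z : nrm z <= M -> nrm (g' z - g z) <= 2 * e.
  move=> zM; apply: le_trans (nrm_le _) _; rewrite reD imD reN imN /= subrr normr0 add0r.
  have zM2 : nrm z <= 2 * M by lra.
  have := hc z zM2; rewrite !ler_norml => /andP[? ?]; case/andP: hw => ? ?.
  by apply/andP; split; lra.
have small (x y : CC R) (t s : R) : 0 <= t <= 1 -> nrm (y - x) <= s ->
    x + rc t * (y - x) = 0 -> nrm x <= s.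
  move=> /andP[t0 t1] yx /eqP; rewrite addr_eq0 => /eqP ->; rewrite nrmN nrm_real_mul //.
  by apply: le_trans yx; rewrite ler_piMl ?nrm_ge0.
exists f', g'; split.
- by rewrite /f'; cts.
- by rewrite /g'; cts.
- move=> z zM; rewrite /f' chi_in // mul1r addrC subrK => Fz; apply/eqP => gz.
  apply: (hz z zM); move: (congr1 (@complex.Re R) Fz) (congr1 (@complex.Im R) Fz) gz => /=.
  by move=> ? ? ?; split; lra.
- move=> t z ht zM; apply/eqP => h.
  have [z2|z2] := leP (nrm z) (2 * M).
    have := small _ _ _ _ ht (near_f z z2) h.
    by have := hd2 z (introT andP (conj zM z2)); lra.
  move: h; rewrite /f' chi_out ?(ltW z2) // mul0r addr0 subrr mulr0 addr0 => /eqP.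
  by rewrite (negbTE (f0 z zM)).
- move=> t z ht zM [h1 h2].
  have zM2 : nrm z <= 2 * M by lra.
  have := small _ _ _ _ ht (near_f z zM2) h1; have := small _ _ _ _ ht (near_g z zM) h2.
  by have := hd1 z zM; lra.
Qed.

End LipschitzApproximation.

(** * Homotopies of quotient maps given by homotopies of numerator and denominator *)

Section PairHomotopy.
Context {R : realType}.
Implicit Types (f g : CC R -> CC R) (z : CC R) (A B : R -> CC R -> CC R).

Lemma continuous_Rmap_family A B :
  continuous (fun p : R * CC R => A p.1 p.2) ->
  continuous (fun p : R * CC R => B p.1 p.2) ->
  (forall t z, ~ (A t z = 0 /\ B t z = 0)) ->
  (forall K : R, exists r : R, forall t z, r <= nrm z -> K * nrm (B t z) < nrm (A t z)) ->
  continuous (fun p : R * Cbar R => Rmap (A p.1) (B p.1) p.2).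
Proof.
move=> cA cB AB ABinf [t [z|]].
  apply: ct_at_Some; apply: (@ct_quot R _ (fun p => A p.1 p.2) (fun p => B p.1 p.2)).
  - exact: cA.
  - exact: cB.
  - exact: AB.
apply: (@cvg_infty R _ (t, None : Cbar R)) => K.
have [r hr] := ABinf K.
have : \forall p \near (t, None : Cbar R), far r p.2.
  have cs : continuous_at (t, None : Cbar R) (fun p : R * Cbar R => p.2) by cts.
  exact: (cs _ (near_infty r)).
apply: filterS => -[s [z|]] //= rz.
by apply: far_quot; apply: hr; exact: ltW.
Qed.

(** Clamping time lets hypotheses on [0, 1] suffice. The growth radius must not depend on time, for
    joint continuity at infinity. *)
Lemma homotopic_pairs A B :
  continuous (fun p : R * CC R => A p.1 p.2) ->
  continuous (fun p : R * CC R => B p.1 p.2) ->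
  (forall (t : R) z, 0 <= t <= 1 -> ~ (A t z = 0 /\ B t z = 0)) ->
  (forall K : R, exists r : R, forall (t : R) z, 0 <= t <= 1 -> r <= nrm z ->
     K * nrm (B t z) < nrm (A t z)) ->
  homotopic R (Rmap (A 0) (B 0)) (Rmap (A 1) (B 1)).
Proof.
move=> cA cB AB ABinf; apply/homotopicP.
have cl (t : R) : 0 <= clamp 0 1 t <= 1 by exact: clamp_range.
have cc : continuous (fun p : R * CC R => (clamp 0 1 p.1, p.2)).
  by cts; apply: ct_clamp; cts.
exists (fun p => Rmap (A (clamp 0 1 p.1)) (B (clamp 0 1 p.1)) p.2); split.
- apply: (@continuous_Rmap_family (fun t => A (clamp 0 1 t)) (fun t => B (clamp 0 1 t))).
  + by move=> p; exact: (@ct_comp _ _ _ (fun p : R * CC R => A p.1 p.2) _ p (cc p) (cA _)).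
  + by move=> p; exact: (@ct_comp _ _ _ (fun p : R * CC R => B p.1 p.2) _ p (cc p) (cB _)).
  + by move=> t z; exact: AB.
  + by move=> K; have [r hr] := ABinf K; exists r => t z; exact: hr.
- by move=> x; rewrite /= clamp_id // lexx ler01.
- by move=> x; rewrite /= clamp_id // lexx ler01.
Qed.

Lemma homotopic_cutoff f g (M : R) : 0 < M -> continuous f -> continuous g ->
  (forall z, ~ (f z = 0 /\ g z = 0)) -> (forall z, M <= nrm z -> f z != 0) ->
  (forall K : R, exists r : R, forall z, r <= nrm z -> K * nrm (g z) < nrm (f z)) ->
  homotopic R (Rmap f g) (Rmap f (fun z => chi M z * g z)).
Proof.
move=> M0 cf cg fg f0 fginf; have cchi := @continuous_chi R M.
pose B (t : R) z := (1 + rc t * (chi M z - 1)) * g z.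
have -> : g = B 0 by apply/funext => z; rewrite /B rc0 mul0r addr0 mul1r.
have -> : (fun z => chi M z * B 0 z) = B 1.
  by apply/funext => z; rewrite /B rc0 rc1 mul0r !mul1r addr0 mul1r addrC subrK.
apply: (@homotopic_pairs (fun=> f) B).
- by cts.
- by rewrite /B; cts.
- move=> t z _; have [zM|zM] := leP (nrm z) M.
    by rewrite /B chi_in // subrr mulr0 addr0 mul1r; exact: fg.
  by case=> /eqP; rewrite (negbTE (f0 z (ltW zM))).
(* The multiplier of [g] stays in [0, 1], but shrinking |g| lowers K |g| only when K is
   nonnegative. *)
- move=> K; have [r hr] := fginf `|K|; exists r => t z /andP[t0 t1] rz.
  apply: le_lt_trans (hr z rz).
  have [x /andP[x0 x1] ex] := chi_range M z.
  rewrite /B ex nrmM -rc1 -rcB -rcM -rcD nrm_real.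
  have h : 0 <= 1 + t * (x - 1) <= 1 by apply/andP; split; nra.
  rewrite ger0_norm; last by case/andP: h.
  apply: le_trans (_ : `|K| * ((1 + t * (x - 1)) * nrm (g z)) <= _).
    by rewrite ler_wpM2r ?ler_norm // mulr_ge0 ?nrm_ge0 //; case/andP: h.
  rewrite ler_wpM2l // ler_piMl ?nrm_ge0 //; by case/andP: h.
Qed.

(** The denominator is 1 on the disc and 0 beyond 2 M: the first excludes common zeros inside, the
    second makes the growth condition mere nonvanishing. *)
Lemma homotopic_chi A (M : R) : 0 < M ->
  continuous (fun p : R * CC R => A p.1 p.2) ->
  (forall (t : R) z, 0 <= t <= 1 -> M <= nrm z -> A t z != 0) ->
  homotopic R (Rmap (A 0) (chi M)) (Rmap (A 1) (chi M)).
Proof.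
move=> M0 cA A0; have cchi := @continuous_chi R M.
apply: (@homotopic_pairs A (fun=> chi M)); [exact: cA | by cts | |].
- move=> t z ht [a0 c0]; have [zM|zM] := leP (nrm z) M.
    by move/eqP: c0; rewrite chi_in // oner_eq0.
  by move/eqP: a0; rewrite (negbTE (A0 t z ht (ltW zM))).
- move=> K; exists (2 * M) => t z ht zM.
  by rewrite chi_out // nrm0 mulr0 nrm_gt0; apply: A0 => //; lra.
Qed.

Lemma homotopic_chi_linear f g (M : R) : 0 < M -> continuous f -> continuous g ->
  (forall (t : R) z, 0 <= t <= 1 -> M <= nrm z -> f z + rc t * (g z - f z) != 0) ->
  homotopic R (Rmap f (chi M)) (Rmap g (chi M)).
Proof.
move=> M0 cf cg fg; pose A (t : R) z := f z + rc t * (g z - f z).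
have -> : f = A 0 by apply/funext => z; rewrite /A rc0 mul0r addr0.
have -> : g = A 1 by apply/funext => z; rewrite /A rc1 mul1r addrC subrK.
by apply: homotopic_chi; [exact: M0 | rewrite /A; cts | exact: fg].
Qed.

(* After the perturbation, a zero of [f'] is never a point where [g'] is real, so the
   segment from [g'] to 1 avoids 0 over the zeros of [f']. *)
Lemma homotopic_denominator f g (M : R) : 0 < M -> continuous f -> continuous g ->
  (forall z, ~ (f z = 0 /\ g z = 0)) -> (forall z, M <= nrm z -> f z != 0) ->
  homotopic R (Rmap f (fun z => chi M z * g z)) (Rmap f (chi M)).
Proof.
move=> M0 cf cg fg f0; have cchi := @continuous_chi R M.
have [f' [g' [cf' cg' P1 P2 P3]]] := perturbation cf cg fg M0 f0.
have z01 : 0 <= (0 : R) <= 1 by rewrite lexx ler01.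
have o01 : 0 <= (1 : R) <= 1 by rewrite lexx ler01.
have f0' z : M <= nrm z -> f' z != 0.
  by move=> zM; have := P2 1 z o01 zM; rewrite rc1 mul1r addrC subrK.
apply: (@homotopic_trans _ _ _ (Rmap f' (fun z => chi M z * g' z))).
  pose A (t : R) z := f z + rc t * (f' z - f z).
  pose B (t : R) z := chi M z * (g z + rc t * (g' z - g z)).
  have -> : f = A 0 by apply/funext => z; rewrite /A rc0 mul0r addr0.
  have -> : f' = A 1 by apply/funext => z; rewrite /A rc1 mul1r addrC subrK.
  have -> : (fun z => chi M z * g z) = B 0 by apply/funext => z; rewrite /B rc0 mul0r addr0.
  have -> : (fun z => chi M z * g' z) = B 1.
    by apply/funext => z; rewrite /B rc1 mul1r [g z + _]addrC subrK.
  apply: homotopic_pairs; [by rewrite /A; cts | by rewrite /B; cts | |].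
  - move=> t z ht; have [zM|zM] := leP (nrm z) M.
      by rewrite /B chi_in // mul1r; exact: P3.
    by case=> /eqP; rewrite (negbTE (P2 t z ht (ltW zM))).
  - move=> K; exists (2 * M) => t z ht zM.
    by rewrite /B chi_out // mul0r nrm0 mulr0 nrm_gt0; apply: P2 => //; lra.
apply: (@homotopic_trans _ _ _ (Rmap f' (chi M))).
  pose B (t : R) z := chi M z * (g' z + rc t * (1 - g' z)).
  have -> : (fun z => chi M z * g' z) = B 0 by apply/funext => z; rewrite /B rc0 mul0r addr0.
  have -> : chi M = B 1.
    by apply/funext => z; rewrite /B rc1 mul1r [g' z + _]addrC subrK mulr1.
  apply: (@homotopic_pairs (fun=> f') B); [by cts | by rewrite /B; cts | |].
  - move=> t z ht; have [zM|zM] := leP (nrm z) M; last first.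
      by case=> /eqP; rewrite (negbTE (f0' z (ltW zM))).
    rewrite /B chi_in // mul1r => -[/(P1 z zM) gi h].
    move: (congr1 (@complex.Im R) h) (congr1 (@complex.Re R) h).
    rewrite !(imD, imM, reD, reM, imN, reN, re_rc, im_rc) /= !mul0r !subr0 !addr0 add0r.
    (* The imaginary part forces t = 1, where the segment has arrived at 1. *)
    move=> hi hr; have : (1 - t) * im (g' z) = 0 by lra.
    move=> /eqP; rewrite mulf_eq0 (negbTE gi) orbF subr_eq0 => /eqP t1.
    by move: hr; rewrite -t1; lra.
  - move=> K; exists (2 * M) => t z ht zM.
    by rewrite /B chi_out // mul0r nrm0 mulr0 nrm_gt0; apply: f0' => //; lra.
apply: homotopic_sym; apply: homotopic_chi_linear; [exact: M0 | exact: cf | exact: cf' |].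
exact: P2.
Qed.

End PairHomotopy.

(** * From a homotopy of loops to a homotopy of maps of the sphere *)

Section AngularHomotopy.
Context {R : realType}.
Implicit Types (z : CC R) (G : R * R -> CC R).

(* A family of loops on [0, 2 pi] as a family of functions on the punctured plane. *)
Definition angular G (t : R) z : CC R :=
  if 0 <= im z then G (t, ang z) else G (t, 2 * pi - ang z).

Lemma ang_real z : z != 0 -> im z = 0 -> ang z = 0 \/ ang z = pi.
Proof.
move=> z0 iz; have [_ s] := ang_cos_sin z0; have /andP[a0 ap] := ang_range z0.
move: s; rewrite iz normr0 => /eqP; rewrite mulf_eq0 nrm_eq0 (negbTE z0) /= => /eqP s0.
move: a0 ap; rewrite !le_eqVlt => /orP[/eqP <-|a0]; first by left.
move=> /orP[/eqP|ap]; first by right.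
by have := sin_gt0_pi (introT andP (conj a0 ap)); rewrite s0 ltxx.
Qed.

(** The branches meet on the real axis: on its positive half because the loops close, on its
    negative half because both angles are pi. *)
Lemma ct_angular G (t : R) z : continuous G -> (forall s, G (s, 0) = G (s, 2 * pi)) ->
  z != 0 -> continuous_at (t, z) (fun p : R * CC R => angular G p.1 p.2).
Proof.
move=> cG Gl z0.
have ca : continuous_at (t, z) (fun p : R * CC R => ang p.2).
  by apply: (@ct_comp _ _ _ ang snd); [cts | exact: ct_ang].
apply: ct_glue; [by cts | | |].
- by apply: (@ct_comp _ _ _ G); [cts | exact: cG].
- by apply: (@ct_comp _ _ _ G (fun p : R * CC R => (p.1, 2 * pi - ang p.2)));
    [cts | exact: cG].
- move=> /= /(ang_real z0)[] ->; first by rewrite subr0.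
  by congr (G (_, _)); lra.
Qed.

Lemma angularE G z : z != 0 -> exists phi : R, [/\ 0 <= phi <= 2 * pi,
  z = rc (nrm z) * expi phi & forall t, angular G t z = G (t, phi)].
Proof.
move=> z0; have [c s] := ang_cos_sin z0; have /andP[a0 ap] := ang_range z0.
have p0 := pi_ge0 R.
rewrite /angular; have [i0|i0] := leP 0 (im z).
  exists (ang z); split=> //; first by apply/andP; split; lra.
  apply: complexP; rewrite ?reM ?imM re_rc im_rc !mul0r ?subr0 ?addr0 //=.
  by rewrite s ger0_norm.
exists (2 * pi - ang z); split=> //; first by apply/andP; split; lra.
rewrite expiD expi2pi mul1r.
apply: complexP; rewrite ?reM ?imM re_rc im_rc !mul0r ?subr0 ?addr0 /=.
  by rewrite cosN c.
by rewrite sinN mulrN s ltr0_norm // opprK.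
Qed.

(** Damps [angular], which in general has no limit at the origin, without changing it outside the
    disc of radius M. *)
Definition kap (M : R) z : CC R := rc (clamp 0 1 (2 * nrm z / M - 1)).

Lemma kap_out (M : R) z : 0 < M -> M <= nrm z -> kap M z = 1.
Proof.
move=> M0 zM; rewrite /kap clamp_ge ?rc1 // lerBrDl ler_pdivlMr //; lra.
Qed.

Lemma kap_in (M : R) z : 0 < M -> nrm z <= M / 2 -> kap M z = 0.
Proof.
by move=> M0 zM; rewrite /kap clamp_le ?rc0 // subr_le0 ler_pdivrMr //; lra.
Qed.

Lemma continuous_kap M : continuous (kap M).
Proof. by move=> z; rewrite /kap; apply: ct_real; apply: ct_clamp; cts. Qed.

Lemma continuous_kap_angular G (M : R) : 0 < M -> continuous G ->
  (forall s, G (s, 0) = G (s, 2 * pi)) ->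
  continuous (fun p : R * CC R => kap M p.2 * angular G p.1 p.2).
Proof.
move=> M0 cG Gl [t z]; have ck := @continuous_kap M.
have [->|z0] := eqVneq z 0; last first.
  by apply: ctM; [cts | exact: ct_angular].
have cn : continuous_at (t, 0 : CC R) (fun p : R * CC R => nrm p.2) by cts.
apply: (@ct_near _ _ (fun=> 0)); last exact: ct_cst.
have h : nrm (0 : CC R) < M / 2 by rewrite nrm0 divr_gt0.
have := ct_lt cn h; apply: filterS => p /ltW pM.
by rewrite kap_in // mul0r.
Qed.

Lemma pw_rc d (x : R) z : pw d (rc x * z) = rc (x ^+ absz d) * pw d z.
Proof. by rewrite /pw; case: ifP => _; rewrite ?conj_mul ?conj_rc exprMn rcX. Qed.

(** For n = 0 the standard map is the constant 1 and does not fix infinity, so the cutoff is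
    extended by 0 at infinity and moved linearly to 1 under the numerator 1. Otherwise |z|^|n| grows
    and the cutoff can be removed. *)
Lemma std_map_homotopic (M : R) (n : int) : 0 < M ->
  homotopic R (Rmap (@pw R n) (chi M)) (@std_map R n).
Proof.
move=> M0; have cchi := @continuous_chi R M; have cpw := @continuous_pw R n.
have [n0|n0] := eqVneq n 0.
  pose h (y : Cbar R) : CC R := if y is Some z then chi M z else 0.
  have ch : continuous h.
    have M2 : 0 <= 2 * M by rewrite mulr_ge0 // ltW.
    apply: (continuous_Cbar M2); first exact: cchi.
    move=> z _ /=; rewrite subr0; have [zM|zM] := leP (2 * M) (nrm z).
      by rewrite chi_out // nrm0 mul0r.
    have [x /andP[x0 x1] ->] := chi_range M z; rewrite nrm_real ger0_norm //.
    by apply: le_trans (ltW zM); rewrite ler_piMl // nrm_ge0.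
  apply/homotopicP; exists (fun p => quot 1 (h p.2 + rc p.1 * (1 - h p.2))); split.
  - move=> p; apply: ct_quot; [by cts | by cts |].
    by case=> /eqP; rewrite oner_eq0.
  - move=> y; rewrite /= rc0 mul0r addr0 n0; case: y => [z|] /=; last first.
      by rewrite /quot eqxx.
    by rewrite /quot /pw /= expr0.
  - move=> y; rewrite /= rc1 mul1r [h y + _]addrC subrK n0 /quot oner_eq0 divr1.
    by case: y.
have -> : @std_map R n = Rmap (@pw R n) (fun=> 1).
  apply/funext => -[z|] /=; last by rewrite (negbTE n0).
  by rewrite oner_eq0 divr1.
apply: homotopic_sym.
have -> : chi M = (fun z => chi M z * 1) by apply/funext => z; rewrite mulr1.
apply: homotopic_cutoff; [exact: M0 | exact: cpw | by cts | | |].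
- by move=> z [_ /eqP]; rewrite oner_eq0.
- by move=> z zM; apply: pw_neq0; rewrite -nrm_gt0; exact: lt_le_trans zM.
- move=> K; exists (1 + `|K|) => z zK; rewrite nrm1 mulr1.
  have -> : nrm (pw n z) = nrm z ^+ absz n.
    by rewrite /pw; case: ifP => _; rewrite nrmX ?nrm_conj.
  have K0 := normr_ge0 K; have K1 := ler_norm K.
  apply: lt_le_trans (_ : nrm z <= _); first by lra.
  by apply: ler_eXnr; [rewrite lt0n absz_eq0 | lra].
Qed.

(** Once the denominator is [chi M], the numerator may be changed freely as long as it has no zero
    outside the disc. *)
Lemma has_winding_has_degree (f g : CC R -> CC R) (M : R) (n : int) : 0 < M ->
  continuous f -> continuous g -> (forall z, ~ (f z = 0 /\ g z = 0)) ->
  (forall z, M <= nrm z -> f z != 0) ->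
  (forall K : R, exists r : R, forall z, r <= nrm z -> K * nrm (g z) < nrm (f z)) ->
  has_winding (fun phi => f (rc M * expi phi)) n -> has_degree (Rmap f g) n.
Proof.
move=> M0 cf cg fg f0 fginf /has_winding_global[G [cG Gn0 Gl G0 G1]].
have z01 : 0 <= (0 : R) <= 1 by rewrite lexx ler01.
have cA := continuous_kap_angular M0 cG Gl; have cpw := @continuous_pw R n.
pose A t z := kap M z * angular G t z.
have cAt t : continuous (A t).
  move=> z; apply: (@ct_comp _ _ _ (fun p : R * CC R => A p.1 p.2) (fun z => (t, z))).
    by cts.
  exact: cA.
have big z : M <= nrm z -> z != 0 by rewrite -nrm_gt0; exact: lt_le_trans.
apply: (homotopic_trans (homotopic_cutoff M0 cf cg fg f0 fginf)).
apply: (homotopic_trans (homotopic_denominator M0 cf cg fg f0)).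
(* Radial retraction onto the disc: outside it, f(rho z) depends on the angle of z only and runs
   through the given loop. *)
pose rho z : CC R := rc (M / Num.max (nrm z) M) * z.
have crho : continuous rho.
  move=> z; rewrite /rho; cts.
  by rewrite gt_eqF // lt_max M0 orbT.
have rhoE z : M <= nrm z -> rho z = rc (M / nrm z) * z.
  by move=> zM; rewrite /rho (max_idPl zM).
apply: (@homotopic_trans _ _ _ (Rmap (fun z => f (rho z)) (chi M))).
  pose B (t : R) z := f (z + rc t * (rho z - z)).
  have e0 : f = B 0 by apply/funext => z; rewrite /B rc0 mul0r addr0.
  have e1 : (fun z => f (rho z)) = B 1.
    by apply/funext => z; rewrite /B rc1 mul1r addrC subrK.
  rewrite e1 {1}e0; apply: homotopic_chi; [exact: M0 | by rewrite /B; cts |].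
  (* The segment from z to rho z is radial and keeps modulus at least M. *)
  move=> t z /andP[t0 t1] zM; apply: f0; rewrite rhoE //.
  have zp : 0 < nrm z by exact: lt_le_trans zM.
  have -> : z + rc t * (rc (M / nrm z) * z - z) = rc (1 + t * (M / nrm z - 1)) * z.
    by rewrite !(rcD, rcN, rcM, rc1); ring.
  rewrite nrmM nrm_real; apply: le_trans (_ : (1 + t * (M / nrm z - 1)) * nrm z <= _).
    have -> : (1 + t * (M / nrm z - 1)) * nrm z = nrm z + t * (M - nrm z).
      by field; rewrite gt_eqF.
    by nra.
  by rewrite ler_wpM2r ?nrm_ge0 // ler_norm.
apply: (@homotopic_trans _ _ _ (Rmap (A 0) (chi M))).
  apply: homotopic_chi_linear; [exact: M0 | by cts | exact: cAt |].
  move=> t z ht zM; have [phi [hp zE aE]] := angularE G (big z zM).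
  have zp : 0 < nrm z by exact: lt_le_trans zM.
  have e : f (rho z) = A 0 z.
    rewrite /A kap_out // mul1r aE G0 // rhoE // {2}zE mulrA -rcM divfK //.
    by rewrite gt_eqF.
  by rewrite e subrr mulr0 addr0 /A kap_out // mul1r aE.
apply: (@homotopic_trans _ _ _ (Rmap (A 1) (chi M))).
  apply: homotopic_chi; [exact: M0 | exact: cA |].
  move=> t z ht zM; have [phi [hp zE aE]] := angularE G (big z zM).
  by rewrite /A kap_out // mul1r aE.
apply: homotopic_trans (std_map_homotopic n M0).
apply: homotopic_chi_linear; [exact: M0 | exact: cAt | exact: cpw |].
move=> t z /andP[t0 t1] zM; have [phi [hp zE aE]] := angularE G (big z zM).
have zp : 0 < nrm z by exact: lt_le_trans zM.
(* Here the numerators are e^{i n phi} and |z|^|n| e^{i n phi}, positive multiples of each other. *)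
rewrite /A kap_out // mul1r aE G1 // {1}zE pw_rc pw_expi.
have -> : expi phi ^ n + rc t * (rc (nrm z ^+ absz n) * expi phi ^ n - expi phi ^ n) =
    rc (1 + t * (nrm z ^+ absz n - 1)) * expi phi ^ n.
  by rewrite !(rcD, rcN, rcM, rc1); ring.
apply: mulf_neq0; last by rewrite expiXz expi_neq0.
have xp : 0 < nrm z ^+ absz n by rewrite exprn_gt0.
rewrite rc_eq0 gt_eqF //; have [->|tn] := eqVneq t 0; first by rewrite mul0r addr0.
have tp : 0 < t by rewrite lt_def tn.
by nra.
Qed.

End AngularHomotopy.

(** * Continuity of the quotient map and equality of degree and winding number *)

Unset Implicit Arguments.
Set Strict Implicit.

Theorem theorem1 (R : realType) (f g : CC R -> CC R) (M : R) :
  continuous f -> continuous g ->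
  (forall z, ~ (f z = 0 /\ g z = 0)) ->
  (forall K : R, exists r : R, forall z : CC R,
     r%:C <= `|z| -> g z != 0 -> K%:C < `|f z / g z|) ->
  0 < M ->
  (forall z : CC R, M%:C <= `|z| -> f z != 0) ->
  continuous (Rmap f g) /\
  (exists n : int, has_winding (fun phi : R => f (M%:C * expi phi)) n) /\
  (forall n : int,
     has_winding (fun phi : R => f (M%:C * expi phi)) n <->
     has_degree (Rmap f g) n).
Proof.
move=> cf cg fg hinf M0 hf0.
have f0 z : M <= nrm z -> f z != 0 by move=> zM; apply: hf0; rewrite normCE lecR.
have fginf (K : R) : exists r : R, forall z, r <= nrm z -> K * nrm (g z) < nrm (f z).
  (* The limit hypothesis is silent at zeros of [g]; a radius of at least M covers them, since [f]
     does not vanish there. *)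
  have [r hr] := hinf K; exists (Num.max r M) => z; rewrite ge_max => /andP[rz Mz].
  have [gz|gz] := eqVneq (g z) 0; first by rewrite gz nrm0 mulr0 nrm_gt0 f0.
  have := hr z; rewrite normCE lecR => /(_ rz gz).
  by rewrite normCE ltcR nrmM nrmV ltr_pdivlMr // nrm_gt0.
have cR : continuous (Rmap f g).
  have cH : continuous (fun p : R * Cbar R => Rmap f g p.2).
    apply: (@continuous_Rmap_family R (fun=> f) (fun=> g)); [by cts | by cts | by [] |].
    by move=> K; have [r hr] := fginf K; exists r => t z; exact: hr.
  move=> x; apply: (@ct_comp _ _ _ (fun p : R * Cbar R => Rmap f g p.2)
    (fun x => (0 : R, x))); [by cts | exact: cH].
have loop_neq0 phi : f (rc M * expi phi) != 0.
  by apply: f0; rewrite nrm_real_mul ?(ltW M0) // nrm_expi mulr1.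
have loopE : f (rc M * expi 0) = f (rc M * expi (2 * pi)) by rewrite expi0 expi2pi.
have cloop : continuous (fun phi => f (rc M * expi phi)) by cts.
have [n0 wn0] := wind_exists cloop (fun phi _ => loop_neq0 phi) loopE.
have hw0 := wind_has_winding cloop (fun phi _ => loop_neq0 phi) loopE wn0.
have deg n : has_winding (fun phi => f (rc M * expi phi)) n -> has_degree (Rmap f g) n.
  exact: has_winding_has_degree.
split; first exact: cR.
split; first by exists n0; exact: hw0.
move=> n; split; first exact: deg.
(* The loop has some winding number [n0], which is then also a degree, and the degree is unique. *)
move=> hn; have hn0 := deg n0 hw0.
have <- : n0 = n.
  by apply: (@std_map_homotopic_inj R); apply: homotopic_trans hn; exact: homotopic_sym.
exact: hw0.
Qed.
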